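(* The $(2,1)$-form $g=\overline{\phi}\wedge\phi\wedge\psi$ on $\mathbb{O}$ is not in the range of $\overline{\partial}:L^2_{2,0}(\mathbb{O})\dashrightarrow L^2_{2,1}(\mathbb{O})$.
   Context: Fix $\beta>0$. Let $\mathbb{C}^*=\mathbb{C}\setminus\{0\}$, $\Gamma_\beta=\{e^{2k\pi\beta}:k\in\mathbb{Z}\}$ (a multiplicative subgroup of $\mathbb{C}^*$), and let $\mathbb{E}=\mathbb{C}^*/\Gamma_\beta$ be the resulting elliptic curve, with projection $\pi:\mathbb{C}^*\to\mathbb{E}$, $w\mapsto[w]$. Let $\mathbb{P}$ be the complex projective line with inhomogeneous coordinate $z:\mathbb{P}\to\mathbb{C}\cup\{\infty\}$, and $X=\mathbb{P}\times\mathbb{E}$. Define $$\mathbb{O}=\{(z,[w])\in\mathbb{P}\times\mathbb{E}:\ \mathrm{Re}(zw)>0\}$$ (the condition does not depend on the lift $w$ of $[w]$). Let $\phi=\dfrac{dz}{1+|z|^2}$ on $\mathbb{P}$, and let $\psi$ be the holomorphic $1$-form on $\mathbb{E}$ with $\pi^*\psi=dw/w$; the same symbols denote their pullbacks to $X$. $\mathbb{O}$ carries the restriction of the Hermitian metric $ds^2=\phi\otimes\overline{\phi}+\psi\otimes\overline{\psi}$ on $X$, for which $\phi,\psi$ are pointwise orthonormal. $L^2_{p,q}(\mathbb{O})$ is the Hilbert space of square-integrable $(p,q)$-forms on $\mathbb{O}$, and $\overline{\partial}$ denotes the (weak) maximal realization, with domain $\{f\in L^2_{p,q}(\mathbb{O}):\overline{\partial}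 f\in L^2_{p,q+1}(\mathbb{O})\}$, $\overline{\partial} f$ in the sense of distributions. *)

(* Defs.v *)
From HB Require Import structures.
From mathcomp Require Import all_boot all_order all_algebra.
From mathcomp Require Import generic_quotient complex.
From mathcomp Require Import all_classical all_reals all_analysis.

Set Implicit Arguments.
Unset Strict Implicit.
Unset Printing Implicit Defensive.

Import Order.TTheory GRing.Theory Num.Theory numFieldNormedType.Exports.

Local Open Scope classical_set_scope.
Local Open Scope ring_scope.

(* The complex numbers carry their algebra as R[i]; their topology, their real
   differentiable structure and their Lebesgue measure are those of R * R, with
   x + iy seen as the pair (x, y). *)
Notation plane R := (R * R)%type (only parsing).

Definition cplx (R : realType) (p : plane R) : R[i] := Complex p.1 p.2.

Definition sqnorm (R : realType) (c : R[i]) : R := complex.Re c ^+ 2 + complex.Im c ^+ 2.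

Section Lebesgue.
Variable R : realType.

Local Notation mplane := (measurableTypeR R * measurableTypeR R)%type.

Definition leb_plane : set mplane -> \bar R :=
  (@lebesgue_measure R \x @lebesgue_measure R)%E.

HB.instance Definition _ := Measure.copy leb_plane
  (@lebesgue_measure R \x @lebesgue_measure R)%E.

Lemma leb_plane_sigma_finite : sigma_finite setT leb_plane.
Proof.
have /sigma_finiteP[F [TF ndF Foo]] := sigma_finiteT (@lebesgue_measure R).
exists (fun n => F n `*` F n).
  rewrite -setXTT TF predeqE => -[x y]; split.
    move=> [/= [n _ Fnx] [k _ Fky]]; exists (maxn n k) => //; split.
    - by move: x Fnx; exact/subsetPset/ndF/leq_maxl.
    - by move: y Fky; exact/subsetPset/ndF/leq_maxr.
  by move=> [n _ []/= ? ?]; split; exists n.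
move=> k; have [mF Fk] := Foo k.
split; first exact: measurableX.
by rewrite /leb_plane product_measure1E// lte_mul_pinfty// ge0_fin_numE.
Qed.

HB.instance Definition _ :=
  Measure_isSigmaFinite.Build _ _ _ leb_plane leb_plane_sigma_finite.

Definition leb4 : {measure set (mplane * mplane)%type -> \bar R} :=
  (leb_plane \x leb_plane)%E.

End Lebesgue.

Section Manifold.
Variables (R : realType) (beta : R).

Definition punctured : set (plane R) := [set w | w != 0].

Definition Cstar : Type := set_type punctured.
HB.instance Definition _ := Topological.copy Cstar (set_type punctured).

(* the element e^(2 k pi beta) of Gamma_beta, which is real *)
Definition Gamma (k : int) : R := expR (2 * k%:~R * pi * beta).

Definition orbit_eq (w w' : Cstar) : bool :=
  `[< exists k : int, set_val w' = Gamma k *: set_val w >].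

Lemma GammaD k l : Gamma (k + l) = Gamma k * Gamma l.
Proof. by rewrite /Gamma -expRD intrD -!mulrDl -mulrDr. Qed.

Lemma Gamma0 : Gamma 0 = 1.
Proof. by rewrite /Gamma mulr0 !mul0r expR0. Qed.

Lemma orbit_eq_equiv : equiv_class_of orbit_eq.
Proof.
split.
- by move=> w; apply/asboolP; exists 0; rewrite Gamma0 scale1r.
- suff sub w w' : orbit_eq w w' -> orbit_eq w' w.
    by move=> w w'; apply/idP/idP; apply: sub.
  move=> /asboolP[k wE]; apply/asboolP; exists (- k).
  by rewrite wE scalerA -GammaD addNr Gamma0 scale1r.
- move=> w2 w1 w3 /asboolP[k e1] /asboolP[l e2]; apply/asboolP; exists (l + k).
  by rewrite e2 e1 scalerA -GammaD.
Qed.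

Canonical orbit_equiv := EquivRelPack orbit_eq_equiv.

Definition ell_curve : Type :=
  quotient_topology {eq_quot orbit_equiv}%qT.
HB.instance Definition _ := Topological.copy ell_curve
  (quotient_topology {eq_quot orbit_equiv}%qT).

Definition proj_E (w : Cstar) : ell_curve :=
  \pi_(quotient_topology {eq_quot orbit_equiv})%qT w.

Definition proj_line : Type := one_point_compactification (plane R).
HB.instance Definition _ :=
  Topological.copy proj_line (one_point_compactification (plane R)).

Definition surface : Type := (proj_line * ell_curve)%type.
HB.instance Definition _ :=
  Topological.copy surface (proj_line * ell_curve)%type.

(* The points with z = oo, where Re (zw) has no meaning, are not in domO. *)
Definition domO : set surface :=
  [set x | exists (z : plane R) (w : Cstar),
     x = (Some z, proj_E w) /\ 0 < complex.Re (cplx z * cplx (set_val w))].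

(* The covering of C x ell_curve, which contains domO, by C x C^*, and the
   preimage of domO under it, as a subset of C x C. *)
Definition covering (y : plane R * Cstar) : surface := (Some y.1, proj_E y.2).

Definition covO : set (plane R * plane R) :=
  [set (y.1, set_val y.2) | y in covering @^-1` domO].

(* A fundamental domain of the action of the group of the Gamma k on covO. *)
Definition fundO : set (plane R * plane R) :=
  [set p | covO p /\ 1 <= sqnorm (cplx p.2) < Gamma 1 ^+ 2].

End Manifold.

Section Forms.
Variable R : realType.

Local Notation C2 := (plane R * plane R)%type.
Local Notation mplane := (measurableTypeR R * measurableTypeR R)%type.

(* Coefficients of a (non-homogeneous) differential form on a subset of C x C:
   a form is the sum over I of a_I dx_I, where x_0, x_1, x_2, x_3 are the
   coordinates z, w, conj z, conj w, and dx_I is the wedge product of the dx_i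
   for i in I, taken in increasing order. *)
Definition dform : Type := C2 -> {set 'I_4} -> R[i].

Definition iz : 'I_4 := 0.
Definition iw : 'I_4 := 1.
Definition izb : 'I_4 := 2.
Definition iwb : 'I_4 := 3.

Definition dcoord (i : 'I_4) : dform := fun _ I => (I == [set i]%SET)%:R.

Definition add_form (a b : dform) : dform := fun p I => a p I + b p I.

Definition mul_form (F : C2 -> R[i]) (a : dform) : dform := fun p I => F p * a p I.

(* dx_J /\ dx_K = (-1) ^ inversions J K dx_(J u K) for disjoint J and K *)
Definition inversions (J K : {set 'I_4}) : nat :=
  #|[set x : 'I_4 * 'I_4 | [&& x.1 \in J, x.2 \in K & (x.2 < x.1)%N]]%SET|.

Definition wedge_form (a b : dform) : dform := fun p I =>
  \sum_(J : {set 'I_4} | J \subset I)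
    (-1) ^+ inversions J (I :\: J)%SET * a p J * b p (I :\: J)%SET.

Definition hol_part (I : {set 'I_4}) : {set 'I_4} := (I :&: [set iz; iw])%SET.
Definition anti_part (I : {set 'I_4}) : {set 'I_4} := (I :&: [set izb; iwb])%SET.

(* i |-> i + 2 (modulo 4) exchanges z with conj z and w with conj w; the sign
   puts the holomorphic differentials in front of the antiholomorphic ones. *)
Definition conj_form (a : dform) : dform := fun p I =>
  (-1) ^+ (#|hol_part I| * #|anti_part I|)
    * conjc (a p [set (i + 2)%R | i in I]%SET).

Definition of_bidegree (D : set C2) (p q : nat) (a : dform) : Prop :=
  forall x I, D x -> a x I != 0 -> #|hol_part I| = p /\ #|anti_part I| = q.

Definition cderive (F : C2 -> R[i]) (v x : C2) : R[i] :=
  Complex ('D_v (fun y => complex.Re (F y)) x) ('D_v (fun y => complex.Im (F y)) x).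

Definition d_zbar (F : C2 -> R[i]) (x : C2) : R[i] :=
  2^-1 * (cderive F ((1, 0), (0, 0)) x + 'i%C * cderive F ((0, 1), (0, 0)) x).

Definition d_wbar (F : C2 -> R[i]) (x : C2) : R[i] :=
  2^-1 * (cderive F ((0, 0), (1, 0)) x + 'i%C * cderive F ((0, 0), (0, 1)) x).

Definition dbar (a : dform) : dform :=
  add_form (wedge_form (dcoord izb) (fun x I => d_zbar (a^~ I) x))
           (wedge_form (dcoord iwb) (fun x I => d_wbar (a^~ I) x)).

Definition iter_derive (vs : seq C2) (f : C2 -> R) : C2 -> R :=
  foldr (fun v h => 'D_v h) f vs.

Definition smooth_on (D : set C2) (f : C2 -> R) : Prop :=
  forall vs x, D x -> differentiable (iter_derive vs f) x.

Definition smooth_form_on (D : set C2) (a : dform) : Prop :=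
  forall I, smooth_on D (fun x => complex.Re (a x I)) /\
            smooth_on D (fun x => complex.Im (a x I)).

Definition measurable_form_on (D : set C2) (a : dform) : Prop :=
  forall I, measurable_fun (D : set (mplane * mplane))
              (fun x => complex.Re (a x I)) /\
            measurable_fun (D : set (mplane * mplane))
              (fun x => complex.Im (a x I)).

Definition phi_form : dform :=
  mul_form (fun x => (((1 + sqnorm (cplx x.1))^-1)%:C)%C) (dcoord iz).

(* dw / w *)
Definition psi_form : dform := mul_form (fun x => (cplx x.2)^-1) (dcoord iw).

(* The squared pointwise norm, for which the dx_I are orthogonal,
   |dz|^2 = (1 + |z|^2)^2 and |dw|^2 = |w|^2. *)
Definition sqnorm_coord (x : C2) (i : 'I_4) : R :=
  if i \in [set iz; izb]%SET then (1 + sqnorm (cplx x.1)) ^+ 2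
  else sqnorm (cplx x.2).

Definition sqnorm_form (a : dform) (x : C2) : R :=
  \sum_(I : {set 'I_4}) sqnorm (a x I) * \prod_(i in I) sqnorm_coord x i.

(* The density of the Riemannian volume of ds^2 with respect to leb4. *)
Definition vol_density (x : C2) : R :=
  ((1 + sqnorm (cplx x.1)) ^+ 2 * sqnorm (cplx x.2))^-1.

End Forms.

Arguments phi_form R : clear implicits.
Arguments psi_form R : clear implicits.

Section Domain.
Variables (R : realType) (beta : R).

Local Notation C2 := (plane R * plane R)%type.
Local Notation domO := (domO (beta:=beta)).
Local Notation covO := (covO beta).
Local Notation fundO := (fundO beta).

(* The forms on domO are the forms on covO that are invariant under the deck
   transformations (z, w) |-> (z, gamma w), whose pullbacks multiply dw and
   conj dw by gamma. *)
Definition form_on_domO (a : dform R) : Prop :=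
  forall x k I, covO x ->
    ((Gamma beta k ^+ #|(I :&: [set iw; iwb])%SET|)%:C)%C
      * a (x.1, Gamma beta k *: x.2) I = a x I.

Definition L2_form (p q : nat) (a : dform R) : Prop :=
  [/\ form_on_domO a, of_bidegree covO p q a, measurable_form_on covO a
    & (\int[leb4 R]_(x in fundO) (sqnorm_form a x * vol_density x)%:E < +oo)%E].

Definition compactly_supported (a : dform R) : Prop :=
  exists2 K : set (surface beta), compact K /\ K `<=` domO &
    forall y I, domO (covering beta y) -> ~ K (covering beta y) ->
      a (y.1, set_val y.2) I = 0.

Definition test_form (p q : nat) (a : dform R) : Prop :=
  [/\ form_on_domO a, of_bidegree covO p q a, smooth_form_on covO a
    & compactly_supported a].

(* The integral over domO of the top-degree part of a form; the factor comes from
   dz /\ dw /\ conj dz /\ conj dw = 4 dx /\ dy /\ ds /\ dt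
   for z = x + iy and w = s + it. *)
Definition int_domO (a : dform R) : R[i] :=
  4 * Complex (\int[leb4 R]_(x in fundO) complex.Re (a x [set: 'I_4]%SET))%R
              (\int[leb4 R]_(x in fundO) complex.Im (a x [set: 'I_4]%SET))%R.

(* dbar f = g in the sense of distributions, for f of bidegree (p, q) *)
Definition weak_dbar (p q : nat) (f g : dform R) : Prop :=
  forall a, test_form (2 - p) (2 - q.+1) a ->
    int_domO (wedge_form g a) =
      (-1) ^+ (p + q + 1) * int_domO (wedge_form f (dbar a)).

(* The graph of the maximal realization of dbar. *)
Definition dbar_max (p q : nat) (f g : dform R) : Prop :=
  [/\ L2_form p q f, L2_form p q.+1 g & weak_dbar p q f g].

Definition dbar_range (p q : nat) : set (dform R) :=
  [set g | exists f, dbar_max p q f g].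

End Domain.

(* Main.v *)
From HB Require Import structures.
Require Import Defs.
From mathcomp Require Import all_boot all_order all_algebra.
From mathcomp Require Import generic_quotient complex.
From mathcomp Require Import all_classical all_reals all_analysis.
From mathcomp Require Import measurable_realfun.
From mathcomp Require Import ring lra.

(** Write [f = F dz /\ dw]. Being square-integrable means that [F] is
square-integrable for Lebesgue measure over a fundamental domain, and
[dbar f = g] says that [F] is holomorphic in [w] and that its derivative in
[conj z] is [G = (1 + |z|^2)^-2 / w]. In the coordinates [z] and [zw], the domain
is the product of [C \ {0}] and an annulus, and [w F - conj z / (1 + |z|^2)] is
holomorphic there. Square-integrability near [z = 0] and near [z = oo] imposes
incompatible values, 0 and -1, on its Laurent coefficient of [1 / z]: both ends
of the punctured plane have zero capacity, whereas the integral of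
[(1 + |z|^2)^-2] is not zero.

The proof is a quantitative and weak form of this remark, without holomorphic
functions. Test the equation against [u v] times the conjugate of
[d(zw) / (zw)], where [u] is a bump function of [ln |z|^2 / N] and [v] a bump
function of the slope [Im(zw) / Re(zw)], so that the test form is invariant and
compactly supported ([cutoff_form_test]). Since [v] depends on [zw] only, its
derivatives cancel, and the coefficient of [dbar] of the test form is the
derivative of [u] in [conj z] times [v / conj w] ([dbar_cutoff_form]).
- The pairing of the test form with [g] has an integrand of constant sign, which
  is bounded from below on a fixed box. So it is at least some [kappa > 0] that
  does not depend on [N] ([target_pairing_lower_bound]).
- The pairing of [f] with [dbar] of the test form is at most
  [e ||F||^2 + A / (e N)] for every [e > 0], because the Dirichlet integral of the
  logarithmic cut-off [u] is of order [1 / N] ([dbar_pairing_upper_bound]).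

Letting [e] tend to 0 after [N] tends to infinity contradicts the weak
equation. *)

Set Implicit Arguments.
Unset Strict Implicit.
Unset Printing Implicit Defensive.

Import Order.TTheory GRing.Theory Num.Theory numFieldNormedType.Exports.

Local Open Scope classical_set_scope.
Local Open Scope ring_scope.

(** * Bump functions *)

Section Flat.
Context {R : realType}.
Implicit Types (p : {poly R}) (x y : R).

(** Taking every polynomial [p], and not only [p = 1], makes this family of
functions stable under differentiation, which is how their smoothness is
obtained. *)
Definition flat p x : R := if 0 < x then p.[x^-1] * expR (- x^-1) else 0.

Definition flat_deriv p : {poly R} := 'X^2 * (p - p^`()).

(** Each monomial is bounded by a multiple of the exponential, since it occurs in
the exponential series. *)
Lemma poly_le_expR p : exists2 C, 0 <= C & forall y, 0 <= y -> `|p.[y]| <= C * expR y.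
Proof.
exists (\sum_(i < size p) `|p`_i| * (i`!)%:R).
  by apply: sumr_ge0 => i _; rewrite mulr_ge0.
move=> y y0; rewrite horner_coef (le_trans (ler_norm_sum _ _ _))//.
rewrite mulr_suml; apply: ler_sum => i _; rewrite normrM -mulrA.
rewrite ler_wpM2l// normrX ger0_norm//.
case: (nat_of_ord i) => [|n].
  by rewrite expr0 fact0 mul1r -(expR0 R) ler_expR.
rewrite mulrC -ler_pdivrMr ?ltr0n ?fact_gt0//.
by rewrite (le_trans _ (expR_ge1Dxn n y0))// lerDr.
Qed.

Lemma flat_bounded p : exists2 C, 0 <= C & forall x, `|flat p x| <= C.
Proof.
have [C C0 Cp] := poly_le_expR p; exists C => // x; rewrite /flat.
case: ifPn => x0; last by rewrite normr0.
rewrite normrM (ger0_norm (expR_ge0 _)) expRN.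
by rewrite ler_pdivrMr ?expR_gt0// Cp// invr_ge0 ltW.
Qed.

Lemma flatMX p x : flat ('X * p) x = flat p x / x.
Proof.
rewrite /flat; case: ifP => x0; last by rewrite mul0r.
by rewrite hornerM hornerX -mulrA mulrC.
Qed.

(** Away from 0 this is the chain rule. At 0 the difference quotient of [flat p]
at [h] is [flat ('X * p) h], which is [h] times the bounded function
[flat ('X * ('X * p))]. *)
Lemma is_derive_flat p x : is_derive x 1 (flat p) (flat (flat_deriv p) x).
Proof.
have [x0|x0|->] := ltgtP x 0.
- have -> : flat (flat_deriv p) x = 0 by rewrite /flat ltNge (ltW x0).
  apply: (near_eq_is_derive _ (is_derive_cst (0:R) x 1)).
  near=> y; rewrite /flat ltNge ifN// negbK; apply: ltW.
  by near: y; exact: lt_nbhsl.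
- have xn0 : x != 0 by rewrite gt_eqF.
  have dV : is_derive x 1 (fun y : R => y^-1) (- x ^- 2).
    apply: is_derive_eq; [exact: (@is_deriveV _ id)|by rewrite scaler1].
  apply: (@near_eq_is_derive _ _ _ ((horner p \o GRing.inv) * (expR \o (fun y : R => - y^-1)))).
    near=> y; rewrite /flat ifT//.
    by near: y; exact: lt_nbhsr.
  apply: is_derive_eq.
  rewrite /flat x0 /flat_deriv hornerM hornerXn hornerD hornerN.
  rewrite /= -[_ *: _]/(_ * _) -[X in _ + X]/(_ * _).
  by field.
- have [C C0 CE] := flat_bounded ('X * ('X * p)).
  have f0 q : flat q 0 = 0 by rewrite /flat ltxx.
  have lim0 : (fun h : R => h^-1 *: (flat p (h *: 1 + 0) - flat p 0)) @ 0^' --> (0 : R).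
    apply: norm_cvg0; rewrite f0.
    apply: (@squeeze_cvgr _ _ _ _ (cst 0) (fun h : R => C * `|h|)).
    + near=> h; rewrite normr_ge0/= subr0 addr0 [h *: 1]mulr1.
      have hn0 : h != 0 by near: h; exact: nbhs_dnbhs_neq.
      rewrite -[_ *: _]/(_ * _) mulrC -flatMX.
      have -> : flat ('X * p) h = flat ('X * ('X * p)) h * h.
        by rewrite [in RHS]flatMX divfK.
      by rewrite normrM ler_wpM2r.
    + exact: cvg_cst.
    + rewrite -[X in _ --> X](mulr0 C); apply: cvgM; first exact: cvg_cst.
      rewrite -[X in _ --> X](normr0 R); apply: cvg_norm.
      exact: nbhs_dnbhs.
  apply: DeriveDef; first by apply/cvg_ex; exists 0.
  by rewrite f0; exact: cvg_lim lim0.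
Unshelve. all: by end_near. Qed.

Lemma flat_eq0 p x : x <= 0 -> flat p x = 0.
Proof. by rewrite /flat ltNge => ->. Qed.

Lemma flat1_bound x : 0 <= flat 1 x <= 1.
Proof.
rewrite /flat; case: ifPn => x0; last by rewrite lexx ler01.
by rewrite hornerC mul1r expR_ge0 expR_le1 oppr_le0 invr_ge0 ltW.
Qed.

Lemma flat1_gt0 x : 0 < x -> 0 < flat 1 x.
Proof. by move=> x0; rewrite /flat x0 hornerC mul1r expR_gt0. Qed.

Lemma flat1_le x y : x <= y -> flat 1 x <= flat 1 y.
Proof.
move=> xy; have [x0|x0] := leP x 0.
  by rewrite flat_eq0//; case/andP: (flat1_bound y).
have y0 := lt_le_trans x0 xy.
rewrite /flat x0 y0 !hornerC !mul1r ler_expR lerN2 lef_pV2//.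
Qed.

End Flat.

(** * Smoothness of functions given by expressions *)

Section NearDiff.
Context {R : realType} {V W : normedModType R}.

Lemma differentiable_near0 (f : V -> W) (x : V) :
  (\near x, f x = 0) -> differentiable f x.
Proof.
move=> f0.
have flat0 : f \o shift x = cst (f x) + (\0 : {linear V -> W}) +o_ 0 id.
  apply/eqaddoP => _/posnumP[e]; near=> h.
  rewrite /= !fctE (nbhs_singleton f0) /shift /= addr0 subr0.
  have -> : f (h + x) = 0.
    near: h; have := f0; rewrite (near_shift 0) /= subr0.
    by apply: filterS => h /=; rewrite addrC.
  by rewrite normr0 mulr_ge0.
have dE : 'd f x = (\0 : {linear V -> W}) :> (V -> W).
  by apply: diff_unique => //; exact: cst_continuous.
by apply/diff_locallyP; rewrite dE; split => //; exact: cst_continuous.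
Unshelve. all: by end_near. Qed.

(** Differentiability depends only on the germ of a function; it is needed
because iterated derivatives are given by their formulas on an open set only. *)
Lemma near_eq_differentiable (f g : V -> W) (x : V) :
  (\near x, f x = g x) -> differentiable f x -> differentiable g x.
Proof.
move=> fg df.
have -> : g = f + (g - f) by apply/funext => y; rewrite !fctE addrC subrK.
apply: differentiableD => //; apply: differentiable_near0.
by apply: filterS fg => y fgy; rewrite !fctE fgy subrr.
Qed.

Lemma is_diff_comp_derive (g : R -> R) (f df : V -> R) (x : V) (dg : R) :
  is_derive (f x) 1 g dg -> is_diff x f df ->
  is_diff x (g \o f) (fun v => dg * df v).
Proof.
move=> [gd <-] dfx.
have gdiff : differentiable g (f x) by exact/derivable1_diffP.
have gd' : is_diff (f x) g (fun h => h *: 'D_1 g (f x)).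
  by apply: DiffDef => //; rewrite diff1E// derive1E.
apply: (is_diff_eq (is_diff_comp dfx gd')).
by apply/funext => v /=; rewrite -[_ *: _]/(_ * _) mulrC.
Qed.

End NearDiff.

Section Expr.
Context {R : realType}.
Local Notation C2 := (plane R * plane R)%type.

(** The coefficients of the test forms are built from the coordinates by these
operations. The syntax is closed under differentiation, so that such functions
are smooth wherever their expression makes sense, and their derivatives can be
computed by reduction. *)
Inductive expr :=
| ECst of R
| ECrd of bool & bool
| EAdd of expr & expr
| EMul of expr & expr
| EInv of expr
| ELn of expr
| EFlat of {poly R} & expr.

(** The first boolean selects [w] against [z], the second one the imaginary part
against the real part. *)
Definition crd (i j : bool) (x : C2) : R :=
  let y := if i then x.2 else x.1 in if j then y.2 else y.1.

Fixpoint denote (e : expr) (x : C2) : R :=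
  match e with
  | ECst c => c
  | ECrd i j => crd i j x
  | EAdd e1 e2 => denote e1 x + denote e2 x
  | EMul e1 e2 => denote e1 x * denote e2 x
  | EInv e1 => (denote e1 x)^-1
  | ELn e1 => ln (denote e1 x)
  | EFlat p e1 => flat p (denote e1 x)
  end.

Fixpoint defined (e : expr) (x : C2) : Prop :=
  match e with
  | ECst _ | ECrd _ _ => True
  | EAdd e1 e2 | EMul e1 e2 => defined e1 x /\ defined e2 x
  | EInv e1 => defined e1 x /\ denote e1 x != 0
  | ELn e1 => defined e1 x /\ 0 < denote e1 x
  | EFlat _ e1 => defined e1 x
  end.

Fixpoint dexpr (v : C2) (e : expr) : expr :=
  match e with
  | ECst c => ECst 0
  | ECrd i j => ECst (crd i j v)
  | EAdd e1 e2 => EAdd (dexpr v e1) (dexpr v e2)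
  | EMul e1 e2 => EAdd (EMul e1 (dexpr v e2)) (EMul e2 (dexpr v e1))
  | EInv e1 => EMul (EMul (ECst (-1)) (EMul (EInv e1) (EInv e1))) (dexpr v e1)
  | ELn e1 => EMul (EInv e1) (dexpr v e1)
  | EFlat p e1 => EMul (EFlat (flat_deriv p) e1) (dexpr v e1)
  end.

Lemma defined_dexpr v e x : defined e x -> defined (dexpr v e) x.
Proof.
elim: e => [c|i j|e1 IH1 e2 IH2|e1 IH1 e2 IH2|e IH|e IH|p e IH] //=.
- by move=> [/IH1 ? /IH2].
- by move=> [d1 d2]; do !split => //; [exact: IH2|exact: IH1].
- by move=> [/[dup] d /IH ? ?].
- by move=> [/[dup] d /IH ? /lt0r_neq0 ?].
- by move=> /[dup] d /IH.
Qed.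

Lemma crd_continuous i j : continuous (crd i j).
Proof.
move=> x; case: i; case: j => /=.
- by apply: continuous_comp; [exact: cvg_snd|exact: cvg_snd].
- by apply: continuous_comp; [exact: cvg_snd|exact: cvg_fst].
- by apply: continuous_comp; [exact: cvg_fst|exact: cvg_snd].
- by apply: continuous_comp; [exact: cvg_fst|exact: cvg_fst].
Qed.

Lemma crd_linear i j : linear (crd i j : C2 -> R).
Proof. by move=> k x y; case: i; case: j. Qed.

Lemma is_diff_crd i j (x : C2) : is_diff x (crd i j) (crd i j).
Proof.
pose cL : {linear C2 -> R} := HB.pack (crd i j)
  (GRing.isLinear.Build _ _ _ _ _ (@crd_linear i j)).
have cc : continuous cL by exact: crd_continuous.
by apply: DiffDef; [exact: (linear_differentiable (f := cL))|exact: (diff_lin (f := cL))].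
Qed.

Lemma is_diff_expr e x : defined e x ->
  is_diff x (denote e) (fun v => denote (dexpr v e) x).
Proof.
elim: e => [c|i j|e1 IH1 e2 IH2|e1 IH1 e2 IH2|e IH|e IH|p e IH] /=.
- by move=> _; exact: is_diff_cst.
- by move=> _; exact: is_diff_crd.
- by move=> [/IH1 d1 /IH2 d2]; exact: is_diffD.
- by move=> [/IH1 d1 /IH2 d2]; exact: is_diffM.
- move=> [/IH d e0].
  have := @is_diff_comp_derive _ _ GRing.inv _ _ x (- (denote e x) ^- 2) _ d.
  move=> H; apply: is_diff_eq.
    apply: H; apply: is_derive_eq; first exact: (@is_deriveV _ id).
    by rewrite scaler1.
  by apply/funext => v; rewrite mulN1r -expr2 exprVn.
- move=> [/IH d e0]; exact: (is_diff_comp_derive (is_derive1_ln e0)).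
- move=> /IH d; exact: (is_diff_comp_derive (is_derive_flat p _)).
Qed.

Lemma derive_expr e x v : defined e x -> 'D_v (denote e) x = denote (dexpr v e) x.
Proof.
by move=> /is_diff_expr d; rewrite deriveE; [rewrite diff_val|exact: ex_diff].
Qed.

(** The iterated derivatives are again denoted by expressions that make sense on
[D], hence they are differentiable there. *)
Lemma smooth_on_expr (D : set C2) e f : open D -> (forall x, D x -> defined e x) ->
  (forall x, D x -> f x = denote e x) -> smooth_on D f.
Proof.
move=> oD de fE.
have de' vs x : D x -> defined (foldr dexpr e vs) x.
  by elim: vs => [/de|v vs IH /IH] //=; exact: defined_dexpr.
have nearD (g h : C2 -> R) x : (forall y, D y -> g y = h y) -> D x -> \near x, g x = h x.
  by move=> gh Dx; apply: filterS (open_nbhs_nbhs (conj oD Dx)) => y; exact: gh.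
have fE' vs x : D x -> denote (foldr dexpr e vs) x = iter_derive vs f x.
  elim: vs x => [|v vs IH] x Dx /=; first by rewrite fE.
  rewrite -derive_expr; last exact: de'.
  by apply: near_eq_derive; exact: nearD IH Dx.
move=> vs x Dx; apply: near_eq_differentiable (nearD _ _ _ (fE' vs) Dx) _.
by have dvs := is_diff_expr (de' vs x Dx); exact: ex_diff.
Qed.

End Expr.

(** * Geometry of the domain *)

Lemma continuous_pairing (T U V : topologicalType) (f : T -> U) (g : T -> V) :
  continuous f -> continuous g -> continuous (fun x => (f x, g x)).
Proof.
move=> cf cg x; rewrite /continuous_at.
by apply: cvg_pair; [exact: cf|exact: cg].
Qed.

Section Geometry.
Context {R : realType} (beta : R).
Local Notation C2 := (plane R * plane R)%type.

(** The deck transformations scale both by the same positive factor, so that the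
sign of the first one and their quotient are well defined on the domain. *)
Definition re_zw (x : C2) : R := x.1.1 * x.2.1 - x.1.2 * x.2.2.
Definition im_zw (x : C2) : R := x.1.1 * x.2.2 + x.1.2 * x.2.1.

Lemma sqnormE (z : plane R) : sqnorm (cplx z) = z.1 ^+ 2 + z.2 ^+ 2.
Proof. by []. Qed.

Lemma sqnorm_ge0 (z : plane R) : 0 <= sqnorm (cplx z).
Proof. by rewrite sqnormE addr_ge0// sqr_ge0. Qed.

Lemma sqnorm_gt0 (z : plane R) : (0 < sqnorm (cplx z)) = (z != 0).
Proof.
rewrite lt0r sqnorm_ge0 andbT; congr (~~ _).
rewrite sqnormE paddr_eq0 ?sqr_ge0// !sqrf_eq0.
by case: z => a b; rewrite xpair_eqE.
Qed.

Lemma sqnormZ (k : R) (z : plane R) : sqnorm (cplx (k *: z)) = k ^+ 2 * sqnorm (cplx z).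
Proof. by rewrite !sqnormE /= -[_ *: _]/(_ * _) -[X in _ + X ^+ 2]/(_ * _); ring. Qed.

Lemma sqnorm_zw x : re_zw x ^+ 2 + im_zw x ^+ 2 = sqnorm (cplx x.1) * sqnorm (cplx x.2).
Proof. by rewrite !sqnormE /re_zw /im_zw; ring. Qed.

Lemma re_zw_neq0 x : 0 < re_zw x -> x.1 != 0 /\ x.2 != 0.
Proof.
move=> p; have : 0 < sqnorm (cplx x.1) * sqnorm (cplx x.2).
  by rewrite -sqnorm_zw ltr_wpDr ?sqr_ge0// exprn_gt0.
by rewrite mulr_ge0_gt0 ?sqnorm_ge0// !sqnorm_gt0 => /andP.
Qed.

Lemma proj_E_eq (w w' : Cstar R) : proj_E beta w = proj_E beta w' <->
  exists k, set_val w' = Gamma beta k *: set_val w.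
Proof.
split=> [ww'|ww']; last exact/(eqmodP (orbit_equiv beta))/asboolP.
exact/asboolP/(eqmodP (orbit_equiv beta)).
Qed.

Lemma re_zw_deck (k : int) (x : C2) :
  re_zw (x.1, Gamma beta k *: x.2) = Gamma beta k * re_zw x.
Proof.
by rewrite /re_zw /= -[_ *: (x.2).1]/(_ * _) -[_ *: (x.2).2]/(_ * _); ring.
Qed.

Lemma im_zw_deck (k : int) (x : C2) :
  im_zw (x.1, Gamma beta k *: x.2) = Gamma beta k * im_zw x.
Proof.
by rewrite /im_zw /= -[_ *: (x.2).1]/(_ * _) -[_ *: (x.2).2]/(_ * _); ring.
Qed.

Lemma Gamma_gt0 k : 0 < Gamma beta k. Proof. exact: expR_gt0. Qed.

(** The condition does not depend on the lift [w], because the deck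
transformations multiply [zw] by positive reals. *)
Lemma domOE (y : plane R * Cstar R) :
  domO (covering beta y) <-> 0 < re_zw (y.1, set_val y.2).
Proof.
split=> [[z [w [[-> /esym/proj_E_eq[k ->]] p]]]|p]; last by exists y.1, y.2.
by rewrite (re_zw_deck k (z, set_val w)) mulr_gt0// Gamma_gt0.
Qed.

Lemma covOE : covO beta = [set x | 0 < re_zw x].
Proof.
apply/seteqP; split=> [_ [y /domOE p <-]//|x p].
have [_ x2] := re_zw_neq0 p.
exists (x.1, exist _ x.2 (mem_set (x2 : punctured x.2))) => /=; last exact/esym/surjective_pairing.
by apply/domOE; rewrite /= -surjective_pairing.
Qed.

Lemma covO_sqnorm_gt0 (x : C2) : covO beta x -> 0 < sqnorm (cplx x.1) /\ 0 < sqnorm (cplx x.2).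
Proof. by rewrite covOE => /re_zw_neq0[? ?]; rewrite !sqnorm_gt0. Qed.

Lemma re_zwE : re_zw = denote (EAdd (EMul (ECrd false false) (ECrd true false))
  (EMul (ECst (-1)) (EMul (ECrd false true) (ECrd true true)))).
Proof. by apply/funext => x; rewrite /= mulN1r. Qed.

Lemma im_zwE : im_zw = denote (EAdd (EMul (ECrd false false) (ECrd true true))
  (EMul (ECrd false true) (ECrd true false))).
Proof. by []. Qed.

Lemma denote_continuous e : (forall x, defined e x) -> continuous (denote e : C2 -> R).
Proof.
move=> de x; apply: differentiable_continuous.
by have := is_diff_expr (de x) => ?; exact: ex_diff.
Qed.

Lemma re_zw_continuous : continuous re_zw.
Proof. by rewrite re_zwE; apply: denote_continuous. Qed.

Lemma im_zw_continuous : continuous im_zw.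
Proof. by rewrite im_zwE; apply: denote_continuous. Qed.

Lemma sqnorm_continuous : continuous (fun z : plane R => sqnorm (cplx z)).
Proof.
move=> z; rewrite (_ : (fun z => _) = (fun z : plane R => z.1 * z.1 + z.2 * z.2)).
  by apply: cvgD; apply: cvgM; (exact: cvg_fst || exact: cvg_snd).
by apply/funext => y; rewrite sqnormE !expr2.
Qed.

Lemma covO_open : open (covO beta).
Proof.
rewrite covOE; apply: (@open_comp _ _ re_zw [set t | 0 < t]); last exact: open_gt.
by move=> x _; exact: re_zw_continuous.
Qed.

Definition annulus (a b : R) : set (plane R) := [set z | a <= sqnorm (cplx z) <= b].

Lemma annulus_compact a b : compact (annulus a b).
Proof.
have [b0|b0] := leP 0 b; last first.
  rewrite (_ : annulus a b = set0); first exact: compact0.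
  by apply/seteqP; split => // z /= /andP[_] /le_lt_trans/(_ b0); rewrite ltNge sqnorm_ge0.
have -> : annulus a b = (`[- (b + 1), b + 1] `*` `[- (b + 1), b + 1]) `&` annulus a b.
  apply/seteqP; split=> [z zab|z []//]; split => //.
  move/andP: zab => [_]; rewrite sqnormE => zb.
  by split => /=; rewrite in_itv/=; apply/andP; split; nra.
apply: compact_closedI.
  by apply: compact_setX; exact: segment_compact.
rewrite (_ : annulus a b = (fun z => sqnorm (cplx z)) @^-1` `[a, b]); last first.
  by apply/seteqP; split=> z; rewrite /= in_itv.
by apply: preimage_closed; [move=> z _; exact: sqnorm_continuous|exact: interval_closed].
Qed.

(** The topology of [Cstar] is induced from the plane, and a closed annulus of the
plane that avoids 0 lifts continuously to [Cstar]. *)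
Lemma Cstar_annulus_compact a b : 0 < a ->
  compact [set w : Cstar R | annulus a b (set_val w)].
Proof.
move=> a0.
have n0 (w : plane R) : annulus a b w -> w != 0.
  by move=> /andP[aw _]; rewrite -sqnorm_gt0 (lt_le_trans a0).
have one0 : ((1, 0) : plane R) \in @punctured R.
  by rewrite inE /punctured/= -sqnorm_gt0 sqnormE/= expr1n expr0n addr0.
pose lift (w : plane R) : Cstar R :=
  if pselect (w \in @punctured R) is left h then exist _ w h else exist _ (1, 0) one0.
have liftK w : w != 0 -> set_val (lift w) = w.
  by move=> w0; rewrite /lift; case: pselect => // -[]; rewrite inE.
have -> : [set w : Cstar R | annulus a b (set_val w)] = lift @` annulus a b.
  apply/seteqP; split=> [w wab|_ [w wab <-]] /=.
    by exists (set_val w) => //; apply: val_inj; exact: liftK (n0 _ wab).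
  by rewrite liftK// n0.
apply: continuous_compact; last exact: annulus_compact.
apply: continuous_comp_initial.
apply: (@subspace_eq_continuous _ (annulus a b) _
  ((fun w : plane R => w) : subspace (annulus a b) -> plane R)).
  by move=> w; rewrite inE => wab; rewrite /= liftK// n0.
by apply: continuous_subspaceT => w; exact: cvg_id.
Qed.

Lemma covering_continuous : continuous (@covering R beta).
Proof.
apply: (@continuous_pairing _ _ _ (fun y => Some y.1 : proj_line R)
                                  (fun y => proj_E beta y.2)) => y.
  apply: (@continuous_comp _ _ _ (fst : plane R * Cstar R -> _) (Some : _ -> proj_line R)).
    exact: cvg_fst.
  exact: one_point_compactification_some_continuous.
apply: (@continuous_comp _ _ _ (snd : plane R * Cstar R -> _) (@proj_E R beta)).
  exact: cvg_snd.
exact: pi_continuous.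
Qed.

Lemma set_val_continuous : continuous (set_val : Cstar R -> plane R).
Proof. exact: initial_continuous. Qed.

Context (beta_gt0 : 0 < beta).

Lemma Gamma1_gt1 : 1 < Gamma beta 1.
Proof. by rewrite expR_gt1 !mulr_gt0// ?pi_gt0. Qed.

(** The logarithm of [|Gamma k w|^2] is that of [|w|^2] plus [4 pi beta k], and a
suitable [k] brings it between 0 and [4 pi beta]. *)
Lemma fundamental_lift (w : plane R) : w != 0 -> exists k : int,
  annulus 1 (Gamma beta 1 ^+ 2) (Gamma beta k *: w).
Proof.
rewrite -sqnorm_gt0 => w0.
pose l : R := 4 * pi * beta.
have l0 : 0 < l by rewrite !mulr_gt0// pi_gt0.
pose t : R := ln (sqnorm (cplx w)) / l.
have GE k : Gamma beta k ^+ 2 = expR (k%:~R * l).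
  by rewrite /Gamma -expRM_natl; congr expR; rewrite /l; ring.
have wE : sqnorm (cplx w) = expR (t * l) by rewrite /t divfK ?lnK// gt_eqF.
exists (- Num.floor t); rewrite /annulus /= sqnormZ !GE wE -expRD -mulrDl.
have /andP[t1 t2] := floor_itv t.
rewrite -[leLHS]expR0 !ler_expR mulr_ge0 ?(ltW l0)//=; last by rewrite mulrNz; lra.
rewrite ler_pM2r// mulrNz; move: t2; rewrite intrD; lra.
Qed.

(** The compact set is the image of the points over these constraints with [w] in
a closed fundamental annulus. It avoids the boundary of the domain because
[|Im(zw)| <= Re(zw)] and [zw != 0] force [Re(zw) > 0]. *)
Lemma compactly_supported_annulus (a : dform R) (r s : R) :
  (forall x I, covO beta x -> a x I != 0 ->
     annulus r s x.1 /\ `|im_zw x| <= re_zw x) ->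
  0 < r -> compactly_supported beta a.
Proof.
move=> asupp r0.
pose val2 (y : plane R * Cstar R) : C2 := (y.1, set_val y.2).
have val2_cont : continuous val2.
  apply: (@continuous_pairing _ _ _ fst (set_val \o snd)) => y; first exact: cvg_fst.
  by apply: continuous_comp; [exact: cvg_snd|exact: set_val_continuous].
pose K0 := (annulus r s `*` [set w : Cstar R | annulus 1 (Gamma beta 1 ^+ 2) (set_val w)])
  `&` [set y | `|im_zw (val2 y)| <= re_zw (val2 y)].
exists (covering beta @` K0); first split.
- apply: continuous_compact.
    by apply: continuous_subspaceT; exact: covering_continuous.
  apply: compact_closedI.
    by apply: compact_setX; [exact: annulus_compact|exact: Cstar_annulus_compact].
  rewrite (_ : mkset _ = (fun y => re_zw (val2 y) - `|im_zw (val2 y)|) @^-1` [set t | 0 <= t]).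
    apply: preimage_closed; last exact: closed_ge.
    move=> y _; apply: cvgB.
      by apply: continuous_comp; [exact: val2_cont|exact: re_zw_continuous].
    apply: cvg_norm.
    by apply: continuous_comp; [exact: val2_cont|exact: im_zw_continuous].
  by apply/seteqP; split => y; rewrite /= subr_ge0.
- move=> _ [y [[y1 y2] /= pq] <-]; apply/domOE.
  have : 0 < re_zw (val2 y) ^+ 2 + im_zw (val2 y) ^+ 2.
    rewrite sqnorm_zw mulr_gt0//; first by case/andP: y1 => /(lt_le_trans r0).
    by case/andP: y2 => /(lt_le_trans ltr01).
  move=> h; rewrite -[(y.1, _)]/(val2 y) lt0r (le_trans _ pq)// andbT; apply/eqP => p0.
  have {}pq : `|im_zw (val2 y)| <= re_zw (val2 y) := pq.
  by move: pq h; rewrite p0 normr_le0 => /eqP ->; rewrite expr0n addr0 ltxx.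
- move=> y I /domOE py nK; apply/eqP/negP => /negP ay.
  have cy : covO beta (val2 y) by rewrite covOE.
  have [y1 pq] := asupp _ _ cy ay.
  apply: nK.
  have [_ y20] := re_zw_neq0 py.
  have [k yk] := fundamental_lift y20.
  have wn0 : Gamma beta k *: set_val y.2 \in @punctured R.
    by rewrite inE /punctured /= scaler_eq0 negb_or y20 gt_eqF// Gamma_gt0.
  exists (y.1, exist _ (Gamma beta k *: set_val y.2) wn0).
    split; first by split.
    rewrite /mkset [val2 _](_ : _ = ((val2 y).1, Gamma beta k *: (val2 y).2))//.
    by rewrite im_zw_deck re_zw_deck normrM gtr0_norm ?Gamma_gt0// ler_pM2l// Gamma_gt0.
  congr (_, _); apply/esym/proj_E_eq; by exists k.
Qed.

End Geometry.

(** * Wedge products with few nonzero coefficients *)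

Section FormAlgebra.
Context {R : realType}.
Local Notation C2 := (plane R * plane R)%type.
Implicit Types (a b : dform R) (x : C2) (I J K : {set 'I_4}).

Definition concentrated a x J := forall I, I != J -> a x I = 0.

Lemma wedge_concentrated a b x J I : concentrated a x J -> J \subset I ->
  wedge_form a b x I = (-1) ^+ inversions J (I :\: J) * a x J * b x (I :\: J).
Proof.
move=> aJ JI; rewrite /wedge_form (bigD1 J)//= big1 ?addr0// => K /andP[_ KJ].
by rewrite aJ// mulr0 mul0r.
Qed.

Lemma wedge_concentrated2 a b x J K : concentrated a x J -> concentrated b x K ->
  [disjoint J & K]%B -> concentrated (wedge_form a b) x (J :|: K) /\
  wedge_form a b x (J :|: K) = (-1) ^+ inversions J K * a x J * b x K.
Proof.
move=> aJ bK JK; split=> [I IJK|].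
  rewrite /wedge_form big1// => J' J'I; have [eJ|J'J] := eqVneq J' J; last first.
    by rewrite aJ// mulr0 mul0r.
  rewrite eJ in J'I *; rewrite [X in _ * X]bK ?mulr0//; apply: contraNneq IJK => <-.
  by rewrite -{1}(finset.setID I J) (finset.setIidPr J'I).
rewrite (wedge_concentrated _ aJ) ?finset.subsetUl//.
by rewrite finset.setDUl finset.setDv finset.set0U (finset.setDidPl _)// disjoint_sym.
Qed.

Lemma inversions1 (j k : 'I_4) : inversions [set j]%SET [set k]%SET = (k < j)%N.
Proof.
rewrite /inversions; case: ltnP => kj.
  apply: etrans (cards1 (j, k)); congr #|pred_of_set _|; apply/finset.setP => -[a b].
  rewrite !inE xpair_eqE /=.
  by apply/and3P/andP => [[-> ->]//|[/eqP-> /eqP->]]; rewrite !eqxx.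
apply/eqP; rewrite cards_eq0; apply/eqP/finset.setP => -[a b]; rewrite !inE /=.
by apply/and3P => -[/eqP-> /eqP->]; rewrite ltnNge kj.
Qed.

Lemma dcoord_concentrated i x : concentrated (@dcoord R i) x [set i]%SET.
Proof. by move=> I /negPf; rewrite /dcoord => ->. Qed.

Lemma dbar_barbar a x : dbar a x [set izb; iwb]%SET =
  d_zbar (a^~ [set iwb]%SET) x - d_wbar (a^~ [set izb]%SET) x.
Proof.
rewrite /dbar /add_form.
rewrite (wedge_concentrated _ (@dcoord_concentrated _ _)) ?finset.subsetUl//.
rewrite (wedge_concentrated _ (@dcoord_concentrated _ _)) ?finset.subsetUr//.
rewrite /dcoord !eqxx.
have -> : ([set izb; iwb]%SET :\: [set izb]%SET)%SET = [set iwb]%SET.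
  by rewrite finset.setDUl finset.setDv finset.set0U; apply/finset.setDidPl; rewrite finset.disjoints1 inE.
have -> : ([set izb; iwb]%SET :\: [set iwb]%SET)%SET = [set izb]%SET.
  by rewrite finset.setDUl finset.setDv finset.setU0; apply/finset.setDidPl; rewrite finset.disjoints1 inE.
by rewrite !inversions1 /= expr0 expr1 !mulr1 mul1r mulN1r.
Qed.

End FormAlgebra.

(** * The two sides of the weak equation *)

Section TheForm.
Context {R : realType} (beta : R).
Local Notation C2 := (plane R * plane R)%type.
Implicit Types (a b : dform R) (x : C2) (I J K : {set 'I_4}).

Definition target_form : dform R :=
  wedge_form (wedge_form (conj_form (phi_form R)) (phi_form R)) (psi_form R).

(** The coefficient of [target_form] on [dz], [dw] and [conj dz], up to a sign. *)
Definition target_coef x : R[i] := ((((1 + sqnorm (cplx x.1)) ^- 2)%:C)%C / cplx x.2).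

Lemma phi_concentrated x : concentrated (phi_form R) x [set iz]%SET.
Proof. by move=> I /negPf I0; rewrite /phi_form /mul_form /dcoord I0 mulr0. Qed.

Lemma psi_concentrated x : concentrated (psi_form R) x [set iw]%SET.
Proof. by move=> I /negPf I0; rewrite /psi_form /mul_form /dcoord I0 mulr0. Qed.

Lemma conj_phi_concentrated x : concentrated (conj_form (phi_form R)) x [set izb]%SET.
Proof.
move=> I I0; rewrite /conj_form phi_concentrated ?rmorph0 ?mulr0//.
apply: contraNneq I0 => I2; apply/eqP/finset.setP => i; rewrite inE.
have -> : (i \in I) = ((i + 2)%R \in [set (i + 2)%R | i in I]%SET).
  by rewrite (finset.mem_imset (f := +%R^~ 2))//; exact: addIr.
by rewrite I2 inE; case: i => [[|[|[|[|]]]]].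
Qed.

Lemma target_form_coef : exists n, forall x,
  concentrated target_form x (~: [set iwb])%SET /\
  target_form x (~: [set iwb])%SET = (-1) ^+ n * target_coef x.
Proof.
have -> : (~: [set iwb] = [set izb] :|: [set iz] :|: [set iw])%SET.
  by apply/finset.setP => -[[|[|[|[|]]]]] // ?; rewrite !inE.
have d1 : [disjoint [set izb]%SET & [set iz]%SET]%B by rewrite finset.disjoints1 inE.
have d2 : [disjoint ([set izb] :|: [set iz])%SET & [set iw]%SET]%B.
  by rewrite disjoint_sym finset.disjoints1 !inE.
pose n1 := inversions ([set izb] :|: [set iz])%SET [set iw]%SET.
pose n2 := inversions [set izb]%SET [set iz]%SET.
pose n3 := (#|hol_part [set izb]%SET| * #|anti_part [set izb]%SET|)%N.
exists (n1 + n2 + n3)%N => x.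
have [c1 e1] := wedge_concentrated2 (@conj_phi_concentrated x) (@phi_concentrated x) d1.
have [c2 e2] := wedge_concentrated2 c1 (@psi_concentrated x) d2.
split => //; rewrite /target_form e2 e1.
have -> : conj_form (phi_form R) x [set izb]%SET =
    (-1) ^+ n3 * ((1 + sqnorm (cplx x.1))^-1)%:C%C.
  rewrite /conj_form imset_set1 /phi_form /mul_form /dcoord.
  have -> : (izb + 2)%R = iz by exact/val_inj.
  by rewrite eqxx mulr1 /n3; congr (_ * _); rewrite /= oppr0.
rewrite /phi_form /psi_form /mul_form /dcoord !eqxx !mulr1 /target_coef.
by rewrite -exprVn expr2 rmorphM !exprD !mulrA.
Qed.

Lemma Re_sign n (c : R[i]) : complex.Re ((-1) ^+ n * c) = (-1) ^+ n * complex.Re c.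
Proof.
rewrite -signr_odd -[in RHS]signr_odd; case: odd; rewrite ?expr0 ?mul1r// !expr1 !mulN1r.
by rewrite raddfN.
Qed.

Lemma Re_int_domO a : complex.Re (int_domO beta a) =
  4 * (\int[leb4 R]_(x in fundO beta) complex.Re (a x [set: 'I_4]%SET))%R.
Proof. by rewrite /int_domO mulr_natl raddfMn/= mulr_natl. Qed.

Lemma bidegree20_concentrated a x : of_bidegree (covO beta) 2 0 a -> covO beta x ->
  concentrated a x [set iz; iw]%SET.
Proof.
move=> a20 xO I; apply: contraNeq => /(a20 _ _ xO)[hol anti].
have h : hol_part I = [set iz; iw]%SET.
  by apply/eqP; rewrite eqEcard finset.subsetIr hol cards2.
apply/eqP/finset.setP => i.
have := congr1 (fun A : {set _} => i \in A) h.
have /eqP := anti; rewrite cards_eq0 => /eqP/finset.setP/(_ i).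
rewrite !inE; case: i => [[|[|[|[|]]]]] //= ?; rewrite ?andbT ?andbF //.
Qed.

(** The only coefficient of [a] that meets [target_form] is that of [conj dw]. The
sign is left unspecified, as only absolute values of integrals are compared in
the end. *)
Lemma wedge_target_form_top a : exists n, forall x,
  complex.Re (wedge_form target_form a x [set: 'I_4]%SET) =
  (-1) ^+ n * complex.Re (target_coef x * a x [set iwb]%SET).
Proof.
have [n gn] := target_form_coef.
exists (inversions (~: [set iwb]) (~: ~: [set iwb]) + n)%N => x.
have [gc ge] := gn x.
rewrite (wedge_concentrated _ gc) ?finset.subsetT// finset.setTD ge.
by rewrite finset.setCK mulrA -exprD -mulrA Re_sign.
Qed.

(** A form of bidegree (2,0) is a multiple of [dz /\ dw], so that it meets only
the coefficient of [b] on [conj dz /\ conj dw]. *)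
Lemma wedge20_top a b : of_bidegree (covO beta) 2 0 a -> exists n, forall x, covO beta x ->
  complex.Re (wedge_form a b x [set: 'I_4]%SET) =
  (-1) ^+ n * complex.Re (a x [set iz; iw]%SET * b x [set izb; iwb]%SET).
Proof.
move=> a20; exists (inversions [set iz; iw] (~: [set iz; iw]))%N => x xO.
rewrite (wedge_concentrated _ (bidegree20_concentrated a20 xO)) ?finset.subsetT//.
rewrite finset.setTD -mulrA Re_sign.
have -> // : (~: [set iz; iw] = [set izb; iwb])%SET.
by apply/finset.setP => -[[|[|[|[|]]]]] // ?; rewrite !inE.
Qed.

End TheForm.

(** * The test forms *)

Section Bump.
Context {R : realType}.
Implicit Types t : R.

Definition bump t : R := flat 1 (1 - t) * flat 1 (1 + t).

Definition dbump t : R :=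
  flat 1 (1 - t) * flat (flat_deriv 1) (1 + t)
  - flat (flat_deriv 1) (1 - t) * flat 1 (1 + t).

Lemma bump_bound t : 0 <= bump t <= 1.
Proof.
have /andP[a0 a1] := flat1_bound (1 - t); have /andP[b0 b1] := flat1_bound (1 + t).
by rewrite /bump mulr_ge0//= -[leRHS]mulr1 ler_pM.
Qed.

Lemma bump_supp t : bump t != 0 -> `|t| < 1.
Proof.
apply: contraNT; rewrite -leNgt ler_normr => /orP[t1|t1].
  by rewrite /bump flat_eq0 ?mul0r// subr_le0.
by rewrite /bump [flat 1 (1 + t)]flat_eq0 ?mulr0//; lra.
Qed.

Lemma dbump_supp t : dbump t != 0 -> `|t| < 1.
Proof.
apply: contraNT; rewrite -leNgt ler_normr => /orP[t1|t1].
  by rewrite /dbump [flat 1 (1 - t)]flat_eq0 ?[flat _ (1 - t)]flat_eq0 ?mul0r ?subr0//; lra.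
by rewrite /dbump [flat 1 (1 + t)]flat_eq0 ?[flat _ (1 + t)]flat_eq0 ?mulr0 ?subr0//; lra.
Qed.

Lemma bump_ge_half : exists2 c, 0 < c & forall t, `|t| <= 2^-1 -> c <= bump t.
Proof.
have h0 : 0 < flat 1 (2^-1 : R) by apply: flat1_gt0; rewrite invr_gt0.
exists (flat 1 (2^-1) * flat 1 2^-1); first exact: mulr_gt0.
move=> t; rewrite ler_norml => /andP[t1 t2].
by apply: ler_pM; rewrite ?(ltW h0)//; apply: flat1_le; lra.
Qed.

Lemma dbump_bound : exists2 C, 0 < C & forall t, `|dbump t| <= C.
Proof.
have [C C0 CE] := flat_bounded (flat_deriv (1 : {poly R})).
have f1 t : `|flat 1 t| <= 1.
  by have /andP[a0 a1] := flat1_bound t; rewrite ger0_norm.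
exists (C + C + 1); first lra.
move=> t; rewrite (le_trans (ler_normB _ _))// !normrM.
rewrite -[leLHS]addr0 lerD// lerD//.
  by rewrite -[leRHS]mul1r ler_pM.
by rewrite -[leRHS]mulr1 ler_pM.
Qed.

End Bump.

Lemma half_conj_derivative (R : realType) (p q r s : R) :
  2^-1 * (Complex p q + 'i%C * Complex r s) =
  Complex (2^-1 * (p - s)) (2^-1 * (q + r)).
Proof.
have -> : (2^-1 : R[i]) = (2^-1 : R)%:C%C by rewrite fmorphV rmorph_nat.
by apply/eqP; rewrite eq_complex /= !mul0r !mul1r !add0r !subr0 addr0 !eqxx.
Qed.

Lemma real_mul_complex (R : realType) (k p q : R) :
  k%:C%C * Complex p q = Complex (k * p) (k * q).
Proof. by apply/eqP; rewrite eq_complex /= !mul0r subr0 addr0 !eqxx. Qed.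

Section TestForm.
Context {R : realType} (beta L : R).
Local Notation C2 := (plane R * plane R)%type.

Let X : expr := @ECrd R false false.
Let Y : expr := @ECrd R false true.
Let S : expr := @ECrd R true false.
Let T : expr := @ECrd R true true.
Let opp_e (e : @expr R) : expr := EMul (ECst (-1)) e.
Let bump_e (e : @expr R) : expr :=
  EMul (EFlat 1 (EAdd (ECst 1) (opp_e e))) (EFlat 1 (EAdd (ECst 1) e)).
Let zsq : expr := EAdd (EMul X X) (EMul Y Y).
Let wsq : expr := EAdd (EMul S S) (EMul T T).
Let re_e : expr := EAdd (EMul X S) (opp_e (EMul Y T)).
Let im_e : expr := EAdd (EMul X T) (EMul Y S).
Let lz : expr := EMul (ECst L^-1) (ELn zsq).
Let slope : expr := EMul im_e (EInv re_e).
Let cut : expr := EMul (bump_e lz) (bump_e slope).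
Let azr : expr := EMul cut (EMul X (EInv zsq)).
Let azi : expr := EMul cut (EMul Y (EInv zsq)).
Let awr : expr := EMul cut (EMul S (EInv wsq)).
Let awi : expr := EMul cut (EMul T (EInv wsq)).

Definition log_radius (x : C2) : R := L^-1 * ln (sqnorm (cplx x.1)).
Definition zw_slope (x : C2) : R := im_zw x / re_zw x.

Definition cutoff (x : C2) : R := bump (log_radius x) * bump (zw_slope x).

(** With [u] the cut-off in [z] and [v] the one in [zw], this is the form
[u v (dz / z + dw / w)^-], that is [u v] times the conjugate of
[d(zw) / (zw)]. As [v] is a function of [zw] alone, [dbar v] is a multiple of the
conjugate of [d(zw)] and its wedge product with the latter vanishes. *)
Definition cutoff_form : dform R := fun x I =>
  if I == [set izb]%SET then Complex (denote azr x) (denote azi x)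
  else if I == [set iwb]%SET then Complex (denote awr x) (denote awi x)
  else 0.

Let zsqE x : denote zsq x = sqnorm (cplx x.1).
Proof. by rewrite sqnormE !expr2. Qed.
Let wsqE x : denote wsq x = sqnorm (cplx x.2).
Proof. by rewrite sqnormE !expr2. Qed.
Let re_eE x : denote re_e x = re_zw x.
Proof. by rewrite /= mulN1r. Qed.
Let im_eE x : denote im_e x = im_zw x.
Proof. by []. Qed.
Let bump_eE e x : denote (bump_e e) x = bump (denote e x).
Proof. by rewrite /= mulN1r. Qed.
Let slopeE x : denote slope x = zw_slope x.
Proof. by rewrite /zw_slope -re_eE -im_eE. Qed.
Let lzE x : denote lz x = log_radius x.
Proof. by rewrite /log_radius -zsqE. Qed.
Let cutE x : denote cut x = cutoff x.
Proof. by rewrite /cutoff -slopeE -lzE -!bump_eE. Qed.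

Lemma cutoff_form_defined x : covO beta x ->
  [/\ defined cut x, defined azr x, defined azi x, defined awr x & defined awi x].
Proof.
move=> xO; have [z0 w0] := covO_sqnorm_gt0 xO.
have p : 0 < re_zw x by rewrite covOE in xO.
have dc : defined cut x.
  have := re_eE x; have := zsqE x; rewrite /= => e1 e2.
  by rewrite e1 e2 z0 gt_eqF.
have dz : defined (EInv zsq) x by split => //; rewrite zsqE gt_eqF.
have dw : defined (EInv wsq) x by split => //; rewrite wsqE gt_eqF.
by split => //; split => //; split.
Qed.

Lemma cutoff_form_iwb x : cutoff_form x [set iwb]%SET =
  Complex (cutoff x * (x.2.1 / sqnorm (cplx x.2))) (cutoff x * (x.2.2 / sqnorm (cplx x.2))).
Proof. by rewrite /cutoff_form (inj_eq (@finset.set1_inj _))/= eqxx -cutE -wsqE. Qed.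

Lemma cutoff_form_izb x : cutoff_form x [set izb]%SET =
  Complex (cutoff x * (x.1.1 / sqnorm (cplx x.1))) (cutoff x * (x.1.2 / sqnorm (cplx x.1))).
Proof. by rewrite /cutoff_form eqxx -cutE -zsqE. Qed.

Lemma cutoff_form_supp x I : cutoff_form x I != 0 ->
  (I = [set izb]%SET \/ I = [set iwb]%SET) /\ cutoff x != 0.
Proof.
have [->|I1] := eqVneq I [set izb]%SET.
  rewrite cutoff_form_izb => h; split; [by left|]; apply: contraNneq h => ->.
  by rewrite !mul0r.
have [->|I2] := eqVneq I [set iwb]%SET.
  rewrite cutoff_form_iwb => h; split; [by right|]; apply: contraNneq h => ->.
  by rewrite !mul0r.
by rewrite /cutoff_form (negPf I1) (negPf I2) eqxx.
Qed.

Lemma cutoff_deck x k : covO beta x -> cutoff (x.1, Gamma beta k *: x.2) = cutoff x.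
Proof.
move=> xO; have p : 0 < re_zw x by rewrite covOE in xO.
rewrite /cutoff /zw_slope im_zw_deck re_zw_deck.
by rewrite -mulf_div divff ?mul1r// gt_eqF// Gamma_gt0.
Qed.

Context (L0 : 0 < L).

Lemma cutoff_supp x : covO beta x -> `|log_radius x| < 1 -> `|zw_slope x| < 1 ->
  annulus (expR (- L)) (expR L) x.1 /\ `|im_zw x| <= re_zw x.
Proof.
move=> xO; have [z0 w0] := covO_sqnorm_gt0 xO.
have p : 0 < re_zw x by rewrite covOE in xO.
rewrite /log_radius normrM normfV (gtr0_norm L0) ltr_pdivrMl// mulr1 => h1.
rewrite /zw_slope normrM normfV (gtr0_norm p) ltr_pdivrMr// mul1r => /ltW h2.
split => //; move: h1; rewrite ltr_norml => /andP[/ltW h3 /ltW h4].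
by rewrite /annulus /= -[sqnorm _]lnK ?posrE// !ler_expR h3 h4.
Qed.

Lemma cutoff_form_test : 0 < beta -> test_form beta 0 1 cutoff_form.
Proof.
move=> b0; split.
- move=> x k I xO.
  have [->|I1] := eqVneq I [set izb]%SET.
    rewrite !cutoff_form_izb cutoff_deck//.
    have -> : ([set izb] :&: [set iw; iwb])%SET = finset.set0.
      by apply/finset.setP => -[[|[|[|[|]]]]] // ?; rewrite !inE.
    by rewrite cards0 expr0 mul1r.
  have [->|I2] := eqVneq I [set iwb]%SET.
    rewrite !cutoff_form_iwb cutoff_deck//.
    have -> : ([set iwb] :&: [set iw; iwb])%SET = [set iwb]%SET.
      by apply/finset.setP => -[[|[|[|[|]]]]] // ?; rewrite !inE.
    rewrite cards1 expr1 sqnormZ.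
    have [_ w0] := covO_sqnorm_gt0 xO; have k0 := Gamma_gt0 beta k.
    by congr Complex; rewrite /= -[_ *: _]/(_ * _); field; rewrite !gt_eqF.
  by rewrite /cutoff_form (negPf I1) (negPf I2) mulr0.
- move=> x I xO /cutoff_form_supp[[]-> _]; rewrite /hol_part /anti_part; split.
  + apply/eqP; rewrite cards_eq0; apply/eqP/finset.setP => -[[|[|[|[|]]]]] // ?; rewrite !inE //.
  + by rewrite (finset.setIidPl _) ?cards1// finset.sub1set !inE.
  + apply/eqP; rewrite cards_eq0; apply/eqP/finset.setP => -[[|[|[|[|]]]]] // ?; rewrite !inE //.
  + by rewrite (finset.setIidPl _) ?cards1// finset.sub1set !inE.
- have smooth e f : (forall x, covO beta x -> defined e x) -> (f = denote e) -> smooth_on (covO beta) f.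
    by move=> de ->; apply: smooth_on_expr de _ => //; exact: covO_open.
  move=> I; rewrite /cutoff_form.
  case: (I == _) => /=; [|case: (I == _) => /=].
  + by split; [apply: (smooth azr)|apply: (smooth azi)] => // x /cutoff_form_defined[].
  + by split; [apply: (smooth awr)|apply: (smooth awi)] => // x /cutoff_form_defined[].
  + by split; apply: (smooth (ECst 0)).
- apply: (@compactly_supported_annulus _ _ b0 _ (expR (- L)) (expR L)); last exact: expR_gt0.
  move=> x I xO /cutoff_form_supp[_]; rewrite /cutoff mulf_eq0 negb_or => /andP[/bump_supp h1 /bump_supp h2].
  exact: cutoff_supp.
Qed.

Let dbump_eE v e x : denote (dexpr v (bump_e e)) x = dbump (denote e x) * denote (dexpr v e) x.
Proof. by rewrite /= /dbump !mulN1r; ring. Qed.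

Let dcutE v x : denote (dexpr v cut) x =
  bump (log_radius x) * (dbump (zw_slope x) * denote (dexpr v slope) x) +
  bump (zw_slope x) * (dbump (log_radius x) * denote (dexpr v lz) x).
Proof. by rewrite -slopeE -lzE -!dbump_eE -!bump_eE. Qed.

Let dmul_cutE v e x : denote (dexpr v (EMul cut e)) x =
  cutoff x * denote (dexpr v e) x + denote e x * denote (dexpr v cut) x.
Proof. by rewrite -cutE. Qed.

(** The terms in the derivative of the bump of [zw_slope] cancel out between the
two coefficients, which leaves the derivative of the bump of [log_radius], where
[ln |z|^2] has the derivative [1 / conj z]; finally
[1 / (conj z conj w) = zw / |zw|^2]. *)
Lemma dbar_cutoff_form x : covO beta x -> dbar cutoff_form x [set izb; iwb]%SET =
  (dbump (log_radius x) * bump (zw_slope x) /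
    (L * (sqnorm (cplx x.1) * sqnorm (cplx x.2))))%:C%C * Complex (re_zw x) (im_zw x).
Proof.
move=> xO; rewrite dbar_barbar /d_zbar /d_wbar /cderive.
have -> : (fun y => complex.Re (cutoff_form y [set iwb]%SET)) = denote awr.
  by apply/funext => y; rewrite cutoff_form_iwb -cutE -wsqE.
have -> : (fun y => complex.Im (cutoff_form y [set iwb]%SET)) = denote awi.
  by apply/funext => y; rewrite cutoff_form_iwb -cutE -wsqE.
have -> : (fun y => complex.Re (cutoff_form y [set izb]%SET)) = denote azr.
  by apply/funext => y; rewrite cutoff_form_izb -cutE -zsqE.
have -> : (fun y => complex.Im (cutoff_form y [set izb]%SET)) = denote azi.
  by apply/funext => y; rewrite cutoff_form_izb -cutE -zsqE.
have [_ d1 d2 d3 d4] := cutoff_form_defined xO.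
rewrite !derive_expr// !dmul_cutE !dcutE.
rewrite /cutoff.
have [z0 w0] := covO_sqnorm_gt0 xO; have p : 0 < re_zw x by rewrite covOE in xO.
move: (bump (log_radius x)) (dbump (log_radius x)) => U dU.
move: (bump (zw_slope x)) (dbump (zw_slope x)) => V dV.
move: z0 w0 p; rewrite !sqnormE /re_zw /im_zw {}/X {}/Y {}/S {}/T /crd /=.
case: x xO {d1 d2 d3 d4} => -[a b] [s t] xO /= z0 w0 p.
rewrite !half_conj_derivative real_mul_complex -[_ - _]/(Complex (_ - _) (_ - _)).
have zn : a * a + b * b != 0 by rewrite gt_eqF// -!expr2.
have wn : s * s + t * t != 0 by rewrite gt_eqF// -!expr2.
have pn : a * s - b * t != 0 by rewrite gt_eqF.
rewrite !expr2 !mulN1r !(mulr0, addr0, add0r, mulr1, oppr0).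
by congr Complex; field; rewrite wn zn pn (gt_eqF L0).
Qed.

End TestForm.

(** * Monotonicity of integrals without measurability *)

(** The integral of a nonnegative function is the supremum of the integrals of the
simple functions below it, hence it is monotone on all functions. This spares
the measurability of the integrands built from the test forms. *)
Section IntegralMonotone.
Context d (T : measurableType d) (R : realType) (mu : {measure set T -> \bar R}).

Lemma ge0_le_integral_nonmeas (D : set T) (f g : T -> \bar R) :
  (forall x, D x -> (0 <= f x)%E) -> (forall x, D x -> (f x <= g x)%E) ->
  (\int[mu]_(x in D) f x <= \int[mu]_(x in D) g x)%E.
Proof.
move=> f0 fg; have g0 x : D x -> (0 <= g x)%E by move=> Dx; exact: le_trans (f0 x Dx) (fg x Dx).
rewrite !ge0_integralE//; apply: ereal_sup_le => _ [h hf <-].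
exists h => // x; apply: (le_trans (hf x)); rewrite /patch.
by case: ifP => // /set_mem; exact: fg.
Qed.

(** The bound by [C] also makes the integral of [f] finite, so that its real value
is not the default one. *)
Lemma Rintegral_norm_le (D : set T) (f : T -> R) (g : T -> \bar R) (C : R) :
  (forall x, D x -> (`|f x|%:E <= g x)%E) -> (\int[mu]_(x in D) g x <= C%:E)%E ->
  `|\int[mu]_(x in D) f x| <= C.
Proof.
move=> fg gC.
have bnd h : (forall x, 0 <= h x <= `|f x|%:E)%E -> exists2 r, 0 <= r <= C &
    (\int[mu]_(x in D) h x = r%:E)%E.
  move=> hf; have i0 : (0 <= \int[mu]_(x in D) h x)%E.
    by apply: integral_ge0 => x _; case/andP: (hf x).
  have iC : (\int[mu]_(x in D) h x <= C%:E)%E.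
    apply: le_trans gC; apply: ge0_le_integral_nonmeas => x Dx.
      by case/andP: (hf x).
    by apply: le_trans (fg x Dx); case/andP: (hf x).
  move: i0 iC; case: (\int[mu]_(x in D) h x)%E => // r; rewrite !lee_fin => r0 rC.
  by exists r => //; apply/andP.
rewrite /Rintegral integralE.
have [|p /andP[p0 pC] ->] := bnd (EFin \o f)^\+%E.
  by move=> x; rewrite funeposE le_max lexx orbT ge_max !lee_fin ler_norm normr_ge0.
have [|n /andP[n0 nC] ->] := bnd (EFin \o f)^\-%E.
  move=> x; rewrite funenegE le_max lexx orbT ge_max !lee_fin normr_ge0 andbT.
  by rewrite -normrN ler_norm.
by rewrite /= ler_norml; apply/andP; split; lra.
Qed.

Lemma Rintegral_ge_indic (D E : set T) (f : T -> R) (c C : R) :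
  measurable E -> E `<=` D -> 0 <= c -> mu E \is a fin_num ->
  (forall x, D x -> 0 <= f x) -> (forall x, E x -> c <= f x) ->
  (\int[mu]_(x in D) (f x)%:E <= C%:E)%E ->
  c * fine (mu E) <= \int[mu]_(x in D) f x.
Proof.
move=> mE ED c0 Efin f0 cf fC.
have i0 : (0 <= \int[mu]_(x in D) (f x)%:E)%E by exact: integral_ge0.
have ifin : (\int[mu]_(x in D) (f x)%:E)%E \is a fin_num.
  by rewrite ge0_fin_numE// (le_lt_trans fC) ?ltry.
rewrite -lee_fin /Rintegral EFinM !fineK// -integral_cst//.
rewrite integral_mkcond [leRHS]integral_mkcond; apply: ge0_le_integral_nonmeas => x _.
  by rewrite /patch; case: ifP.
rewrite /patch; case: ifPn => [/set_mem Ex|_]; last first.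
  by case: ifP => // /set_mem /f0.
by rewrite ifT ?lee_fin ?cf// inE; exact: ED.
Qed.

(** Pulling out a scalar would need integrability in general; for a sign and a
function of constant sign it does not. *)
Lemma normr_Rintegral_signed (D : set T) (f : T -> R) n :
  (forall x, D x -> 0 <= f x) ->
  `|\int[mu]_(x in D) ((-1) ^+ n * f x)| = \int[mu]_(x in D) f x.
Proof.
move=> f0; have i0 : 0 <= \int[mu]_(x in D) f x by exact: Rintegral_ge0.
rewrite /Rintegral -signr_odd; case: odd; last first.
  by under eq_integral do rewrite expr0 mul1r; rewrite ger0_norm.
under eq_integral do rewrite expr1 mulN1r EFinN.
rewrite integral_ge0N; last by move=> x Dx; rewrite lee_fin f0.
by rewrite fineN normrN ger0_norm.
Qed.

End IntegralMonotone.

(** * The logarithmic area of the cut-off region *)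

Section Box.
Context {R : realType}.
Local Notation mplane := (measurableTypeR R * measurableTypeR R)%type.

Definition box (a1 b1 a2 b2 a3 b3 a4 b4 : R) : set (mplane * mplane) :=
  (`[a1, b1] `*` `[a2, b2]) `*` (`[a3, b3] `*` `[a4, b4]).

Lemma box_measurable a1 b1 a2 b2 a3 b3 a4 b4 : measurable (box a1 b1 a2 b2 a3 b3 a4 b4).
Proof. by apply: measurableX; apply: measurableX; exact: measurable_itv. Qed.

Lemma lebesgue_itv (a b : R) : a <= b -> (lebesgue_measure `[a, b]%classic = (b - a)%:E)%E.
Proof.
move=> ab; rewrite lebesgue_measure_itv /= lte_fin; case: ifPn => // ba.
have -> : b = a by apply/eqP; rewrite eq_le ab andbT leNgt.
by rewrite subrr.
Qed.

Lemma leb_plane_rect (a1 b1 a2 b2 : R) : a1 <= b1 -> a2 <= b2 ->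
  leb_plane (`[a1, b1] `*` `[a2, b2]) = ((b1 - a1) * (b2 - a2))%:E.
Proof.
move=> h1 h2; rewrite EFinM -!lebesgue_itv//.
by apply: product_measure1E; exact: measurable_itv.
Qed.

Lemma leb4_box a1 b1 a2 b2 a3 b3 a4 b4 :
  a1 <= b1 -> a2 <= b2 -> a3 <= b3 -> a4 <= b4 ->
  leb4 R (box a1 b1 a2 b2 a3 b3 a4 b4) =
  (((b1 - a1) * (b2 - a2)) * ((b3 - a3) * (b4 - a4)))%:E.
Proof.
move=> h1 h2 h3 h4; rewrite EFinM -!leb_plane_rect//.
by apply: product_measure1E; apply: measurableX; exact: measurable_itv.
Qed.

End Box.

Section Estimates.
Context {R : realType} (beta : R).
Local Notation C2 := (plane R * plane R)%type.
Local Notation mplane := (measurableTypeR R * measurableTypeR R)%type.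
Local Notation T4 := (mplane * mplane)%type.
Local Notation G := (Gamma beta 1).

Lemma measurable_crd i j : measurable_fun [set: T4] (crd i j : T4 -> R).
Proof.
case: i; case: j.
- exact: (measurableT_comp measurable_snd measurable_snd).
- exact: (measurableT_comp measurable_fst measurable_snd).
- exact: (measurableT_comp measurable_snd measurable_fst).
- exact: (measurableT_comp measurable_fst measurable_fst).
Qed.

Lemma measurable_re_zw : measurable_fun [set: T4] (@re_zw R : T4 -> R).
Proof.
rewrite (_ : @re_zw R = (fun x => crd false false x * crd true false x
   - crd false true x * crd true true x))//.
by apply: measurable_funB; apply: measurable_funM; exact: measurable_crd.
Qed.

Lemma measurable_sqnorm_w : measurable_fun [set: T4] (fun x : T4 => sqnorm (cplx x.2) : R).
Proof.
rewrite (_ : (fun x => _) = (fun x => crd true false x * crd true false x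
   + crd true true x * crd true true x)).
  by apply: measurable_funD; apply: measurable_funM; exact: measurable_crd.
by apply/funext => x; rewrite sqnormE !expr2.
Qed.

Lemma covO_measurable : measurable (covO beta : set T4).
Proof.
rewrite covOE; have := measurable_re_zw measurableT (measurable_itv `]0%R, +oo[).
by rewrite setTI; congr measurable; apply/seteqP; split=> x; rewrite /= in_itv/= andbT.
Qed.

Lemma fundO_covO : fundO beta `<=` covO beta. Proof. by move=> x []. Qed.

Lemma fundO_measurable : measurable (fundO beta : set T4).
Proof.
have := measurableI _ _ covO_measurable (measurable_sqnorm_w measurableT (measurable_itv `[1, G ^+ 2[)).
by rewrite setTI.
Qed.

(** The shell [exp(k - N) <= |z|^2 <= exp(k + 1 - N)] lies in a square of half
side [shell_radius N k], and its area is comparable to [|z|^2]. So each shell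
contributes a bounded amount to the integral of [|z|^-2], and the integral over
[exp(-N) <= |z|^2 <= exp(N)] grows linearly in [N]. *)
Definition shell_radius (N k : nat) : R := expR (2^-1 * (k.+1%:R - N%:R)).

Definition shell_box (N k : nat) : set T4 :=
  box (- shell_radius N k) (shell_radius N k) (- shell_radius N k) (shell_radius N k) (- G) G (- G) G.

(** A bound for [|z|^-2] on the part of the fundamental domain over
[exp(-N) <= |z|^2 <= exp(N)]. The last shell, [k = 2N], is there for
[|z|^2 = exp(N)]. *)
Definition shell_majorant (N : nat) (x : T4) : R :=
  \sum_(k < (N + N).+1) expR (N%:R - k%:R) * \1_(shell_box N k) x.

Lemma shell_box_measure N k :
  leb4 R (shell_box N k) = (expR (k.+1%:R - N%:R) * (16 * G ^+ 2))%:E.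
Proof.
have r0 : 0 <= shell_radius N k by exact: expR_ge0.
have G0 : 0 <= G by exact: expR_ge0.
rewrite /shell_box leb4_box; [|lra..]; congr EFin.
have -> : expR (k.+1%:R - N%:R) = shell_radius N k ^+ 2.
  by rewrite /shell_radius -expRM_natl mulrA mulfV ?mul1r// pnatr_eq0.
by ring.
Qed.

Lemma shell_majorant_ge0 N x : 0 <= shell_majorant N x.
Proof. by apply: sumr_ge0 => k _; rewrite mulr_ge0// expR_ge0. Qed.

Lemma measurable_shell_majorant N : measurable_fun [set: T4] (shell_majorant N).
Proof.
apply: measurable_sum => k; apply: measurable_funM => //.
by apply: measurable_indic; exact: box_measurable.
Qed.

Lemma integral_shell_majorant N :
  (\int[leb4 R]_x (shell_majorant N x)%:E = ((N + N).+1%:R * (16 * expR 1 * G ^+ 2))%:E)%E.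
Proof.
under eq_integral do rewrite /shell_majorant -sumEFin.
have shellM k : measurable_fun [set: T4]
    (fun x => (expR (N%:R - k%:R) * \1_(shell_box N k) x)%:E : \bar R).
  apply/measurable_EFinP; apply: measurable_funM => //.
  by apply: measurable_indic; exact: box_measurable.
have shell0 k (x : T4) : (0 <= (expR (N%:R - k%:R) * \1_(shell_box N k) x)%:E :> \bar R)%E.
  by rewrite lee_fin mulr_ge0// expR_ge0.
rewrite ge0_integral_sum//.
rewrite -[X in (X * _)%:E](@mulr1 R) -mulrA mulr_natl -[in RHS](card_ord (N + N).+1) -sumr_const -sumEFin.
apply: eq_bigr => k _.
under eq_integral do rewrite EFinM.
rewrite ge0_integralZl_EFin ?expR_ge0//; last first.
  by apply/measurable_EFinP; apply: measurable_indic; exact: box_measurable.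
rewrite integral_indic//; last exact: box_measurable.
rewrite setIT; have -> := shell_box_measure N k.
rewrite -[LHS]EFinM; congr EFin; rewrite [LHS]mulrA -expRD.
have -> : N%:R - k%:R + (k.+1%:R - N%:R) = 1 :> R by rewrite -natr1; ring.
by ring.
Qed.

Lemma inv_sqnorm_le_shell_majorant N (x : T4) :
  annulus (expR (- N%:R)) (expR N%:R) x.1 -> sqnorm (cplx x.2) <= G ^+ 2 ->
  (sqnorm (cplx x.1))^-1 <= shell_majorant N x.
Proof.
move=> /andP[z1 z2] wG.
have z0 : 0 < sqnorm (cplx x.1) by apply: lt_le_trans z1; exact: expR_gt0.
pose t := ln (sqnorm (cplx x.1)).
have zE : sqnorm (cplx x.1) = expR t by rewrite /t lnK// posrE.
have [t1 t2] : - N%:R <= t /\ t <= N%:R by split; rewrite -ler_expR -zE.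
pose k := Num.truncn (t + N%:R).
have tN0 : 0 <= t + N%:R by lra.
have /andP[k1 k2] := truncn_itv tN0.
have kN : (k < (N + N).+1)%N.
  by rewrite ltnS -(ler_nat R) natrD (le_trans k1)//; lra.
rewrite /shell_majorant (bigD1 (Ordinal kN))//=.
have sq_le (a b r : R) : 0 <= r -> a ^+ 2 + b ^+ 2 <= r ^+ 2 -> a \in `[- r, r] /\ b \in `[- r, r].
  by move=> r0 h; rewrite !in_itv /=; split; apply/andP; split; nra.
have G0 : 0 <= G by exact: expR_ge0.
have r0 : 0 <= shell_radius N k by exact: expR_ge0.
have -> : \1_(shell_box N k) x = 1 :> R.
  rewrite indicE mem_set//.
  have [a1 a2] := sq_le _ _ _ G0 wG.
  have [] := sq_le x.1.1 x.1.2 (shell_radius N k) r0.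
    rewrite -sqnormE zE /shell_radius -expRM_natl ler_expR mulrA mulfV ?pnatr_eq0// mul1r.
    by rewrite /k in k2 *; lra.
  by move=> b1 b2; split; split.
rewrite mulr1 ler_wpDr//.
  by apply: sumr_ge0 => j _; rewrite mulr_ge0// expR_ge0.
by rewrite zE -expRN ler_expR; rewrite /k in k1 *; lra.
Qed.

End Estimates.

(** * Estimates of the two pairings *)

Section Pairings.
Context {R : realType} (beta : R).
Context (beta_gt0 : 0 < beta).
Local Notation C2 := (plane R * plane R)%type.
Local Notation mplane := (measurableTypeR R * measurableTypeR R)%type.
Local Notation T4 := (mplane * mplane)%type.
Local Notation G := (Gamma beta 1).

Lemma Re_target_coef_cutoff_form (L : R) (x : C2) : covO beta x ->
  complex.Re (target_coef x * cutoff_form L x [set iwb]%SET) =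
  (1 + sqnorm (cplx x.1)) ^- 2 * cutoff L x / sqnorm (cplx x.2).
Proof.
move=> xO; have [_ w0] := covO_sqnorm_gt0 xO.
have wn0 : cplx x.2 != 0.
  by apply/eqP => w; move: w0; rewrite w /sqnorm /= expr0n addr0 ltxx.
rewrite cutoff_form_iwb.
have -> : Complex (cutoff L x * (x.2.1 / sqnorm (cplx x.2)))
    (cutoff L x * (x.2.2 / sqnorm (cplx x.2))) =
    ((cutoff L x / sqnorm (cplx x.2))%:C)%C * cplx x.2.
  by rewrite real_mul_complex; congr Complex; ring.
by rewrite /target_coef mulrACA mulVf// mulr1 -rmorphM /= mulrA.
Qed.

Lemma cutoff_bound (L : R) (x : C2) : 0 <= cutoff L x <= 1.
Proof.
have /andP[a0 a1] := bump_bound (log_radius L x).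
have /andP[b0 b1] := bump_bound (zw_slope x).
by rewrite /cutoff mulr_ge0//= -[leRHS]mulr1 ler_pM.
Qed.

(** As [(1 + |z|^2)^-2] is at most [|z|^-2], the majorant that measures the energy
of the cut-off serves here too, where it only yields that the integral is
finite. *)
Lemma pairing_le_shell_majorant N (x : C2) : (0 < N)%N -> fundO beta x ->
  0 <= complex.Re (target_coef x * cutoff_form N%:R x [set iwb]%SET) <= shell_majorant beta N x.
Proof.
move=> N0 [xO /andP[w1 w2]]; have [z0 w0] := covO_sqnorm_gt0 xO.
have /andP[c0 c1] := cutoff_bound N%:R x.
have q0 : 0 <= (1 + sqnorm (cplx x.1)) ^- 2.
  by rewrite invr_ge0 ltW// exprn_gt0// addr_gt0.
rewrite Re_target_coef_cutoff_form//; apply/andP; split.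
  by apply: mulr_ge0; [exact: mulr_ge0|rewrite invr_ge0 ltW].
have [->|cn0] := eqVneq (cutoff N%:R x) 0.
  by rewrite mulr0 mul0r shell_majorant_ge0.
have NR : (0 : R) < N%:R by rewrite ltr0n.
move: cn0; rewrite {1}/cutoff mulf_eq0 negb_or => /andP[/bump_supp h1 /bump_supp h2].
have [ann _] := cutoff_supp NR xO h1 h2.
apply: le_trans (inv_sqnorm_le_shell_majorant ann (ltW w2)).
set z := sqnorm (cplx x.1) in z0 q0 *; set w := sqnorm (cplx x.2) in w0 w1 *.
rewrite -[leRHS]mulr1; apply: ler_pM.
- exact: mulr_ge0.
- by rewrite invr_ge0 ltW.
- rewrite -[leRHS]mulr1; apply: ler_pM => //.
  have z1 : 0 < (1 + z) ^+ 2 by rewrite exprn_gt0// addr_gt0.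
  by rewrite lef_pV2 ?posrE//; clear -z0; nra.
- by rewrite invf_le1.
Qed.

(** The derivative of the cut-off in the logarithm of [|z|^2] is of order [1 / N],
and it is multiplied by [1 / (conj z conj w)]. *)
Lemma dbar_cutoff_form_bound (C : R) N (x : C2) : (forall t : R, `|dbump t| <= C) ->
  (0 < N)%N -> fundO beta x ->
  sqnorm (dbar (cutoff_form N%:R) x [set izb; iwb]%SET) <= C ^+ 2 / N%:R ^+ 2 * shell_majorant beta N x.
Proof.
move=> CE N0 [xO /andP[w1 w2]]; have [z0 w0] := covO_sqnorm_gt0 xO.
have NR : (0 : R) < N%:R by rewrite ltr0n.
rewrite (dbar_cutoff_form NR xO) real_mul_complex.
set k := _ / (_ * (_ * _)).
have -> : sqnorm (Complex (k * re_zw x) (k * im_zw x)) =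
    (dbump (log_radius N%:R x) * bump (zw_slope x)) ^+ 2 / N%:R ^+ 2 *
    ((sqnorm (cplx x.1))^-1 * (sqnorm (cplx x.2))^-1).
  rewrite {1}/sqnorm [complex.Re _]/= [complex.Im _]/= !exprMn -mulrDr sqnorm_zw /k.
  by field; rewrite !gt_eqF.
have [->|cn0] := eqVneq (dbump (log_radius N%:R x) * bump (zw_slope x)) 0.
  by rewrite expr0n /= !mul0r mulr_ge0 ?shell_majorant_ge0// divr_ge0// sqr_ge0.
move: (cn0); rewrite mulf_eq0 negb_or => /andP[/dbump_supp h1 /bump_supp h2].
have [ann _] := cutoff_supp NR xO h1 h2.
have maj := inv_sqnorm_le_shell_majorant ann (ltW w2).
apply: ler_pM; rewrite ?divr_ge0 ?sqr_ge0 ?mulr_ge0 ?invr_ge0 ?(ltW z0) ?(ltW w0)//.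
  rewrite ler_pM2r ?invr_gt0 ?exprn_gt0// -[leLHS]real_normK ?num_real//.
  rewrite ler_pXn2r ?nnegrE// ?(le_trans (normr_ge0 _) (CE 0))// normrM.
  have /andP[b0 b1] := bump_bound (zw_slope x).
  by rewrite -[leRHS]mulr1 ler_pM// ger0_norm.
apply: le_trans maj; rewrite -[leRHS]mulr1 ler_pM ?invr_ge0 ?(ltW z0) ?(ltW w0)//.
by rewrite invf_le1.
Qed.

Lemma sqnorm_le_form (f : dform R) (x : C2) : covO beta x ->
  sqnorm (f x [set iz; iw]%SET) <= sqnorm_form f x * vol_density x.
Proof.
move=> xO; have [z0 w0] := covO_sqnorm_gt0 xO.
have sq0 (c : R[i]) : 0 <= sqnorm c by rewrite addr_ge0// sqr_ge0.
have co0 i : 0 <= sqnorm_coord x i.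
  by rewrite /sqnorm_coord; case: ifP => _; rewrite ?sqr_ge0// ltW.
have v0 : 0 < vol_density x.
  by rewrite invr_gt0 mulr_gt0// exprn_gt0// addr_gt0.
rewrite /sqnorm_form (bigD1 [set iz; iw]%SET)//= mulrDl.
have -> : \prod_(i in [set iz; iw]%SET) sqnorm_coord x i =
    (1 + sqnorm (cplx x.1)) ^+ 2 * sqnorm (cplx x.2).
  by rewrite big_setU1 ?inE//= big_set1 /sqnorm_coord !inE.
rewrite -mulrA /vol_density mulfV ?mulr1; last first.
  by rewrite gt_eqF// mulr_gt0// exprn_gt0// addr_gt0.
rewrite lerDl mulr_ge0 ?(ltW v0)//.
by apply: sumr_ge0 => I _; rewrite mulr_ge0// prodr_ge0.
Qed.

(** On such a box both cut-offs are bounded from below, uniformly in the scale. *)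
Lemma bump_box : exists2 E : set T4, [/\ measurable E, E `<=` fundO beta,
    leb4 R E \is a fin_num & 0 < fine (leb4 R E)] &
  forall (x : C2), E x ->
    `|zw_slope x| <= 2^-1 /\ 0 <= ln (sqnorm (cplx x.1)) <= 2^-1 /\ sqnorm (cplx x.1) <= 2.
Proof.
have G1 := Gamma1_gt1 beta_gt0.
pose e : R := Num.min (10^-1) ((G - 1) / 3).
have e0 : 0 < e by rewrite lt_min invr_gt0 ltr0n divr_gt0 ?subr_gt0.
have e1 : e <= 10^-1 by rewrite ge_min lexx.
have e2 : e <= (G - 1) / 3 by rewrite ge_min lexx orbT.
have eG : 3 * e <= G - 1 by rewrite -ler_pdivlMl// mulrC.
(* e <= 1/10 keeps Im(zw) small against Re(zw), and e <= (G - 1)/3 keeps w in the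
   fundamental annulus *)
have bE (x : T4) : box 1 (1 + 10^-1) 0 10^-1 1 (1 + e) 0 e x ->
  [/\ 0 < re_zw x, `|im_zw x| <= 2^-1 * re_zw x, 1 <= sqnorm (cplx x.1) <= 1 + 2^-1 &
      1 <= sqnorm (cplx x.2) < G ^+ 2].
  case: x => -[a b] [s t] [[]] /=; rewrite !in_itv /=.
  move=> /andP[a1 a2] /andP[b1 b2] [/andP[s1 s2] /andP[t1 t2]].
  rewrite /re_zw /im_zw !sqnormE /=.
  have as1 : 1 <= a * s by nra.
  have bt1 : b * t <= 100^-1 by nra.
  have at1 : 0 <= a * t <= 11 / 100 by apply/andP; split; nra.
  have bs1 : 0 <= b * s <= 11 / 100 by apply/andP; split; nra.
  case/andP: at1 => at1 at2; case/andP: bs1 => bs1 bs2.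
  split; first lra.
  - by rewrite ger0_norm ?addr_ge0//; lra.
  - by apply/andP; split; nra.
  - by apply/andP; split; nra.
exists (box 1 (1 + 10^-1) 0 10^-1 1 (1 + e) 0 e); first split.
- exact: box_measurable.
- by move=> x /bE[p _ _ w]; split => //; rewrite covOE.
- by rewrite leb4_box//; lra.
- rewrite leb4_box; [|lra..].
  by rewrite /= !mulr_gt0//; lra.
move=> x /bE[p h /andP[z1 z2] _]; split.
  by rewrite /zw_slope normrM normfV (gtr0_norm p) ler_pdivrMr.
split; last lra.
rewrite ln_ge0//=.
have z0 : 0 < sqnorm (cplx x.1) by lra.
have z3 : - 1 < sqnorm (cplx x.1) - 1 by lra.
have := le_ln1Dx z3; rewrite [1 + _](addrC 1) subrK => /le_trans; apply; lra.
Qed.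

(** The arithmetic-geometric mean inequality replaces that of Cauchy-Schwarz, as
it holds pointwise and needs no product of integrals. *)
Lemma Re_mul_le (F D : R[i]) (e : R) : 0 < e ->
  `|complex.Re (F * D)| <= e * sqnorm F + e^-1 * sqnorm D.
Proof.
case: F D => a b [p q] e0; rewrite /sqnorm /=.
have [p' ->] : exists p', p = e * p' by exists (e^-1 * p); rewrite mulrA mulfV ?mul1r// gt_eqF.
have [q' ->] : exists q', q = e * q' by exists (e^-1 * q); rewrite mulrA mulfV ?mul1r// gt_eqF.
have -> : e^-1 * ((e * p') ^+ 2 + (e * q') ^+ 2) = e * (p' ^+ 2 + q' ^+ 2).
  by field; rewrite gt_eqF.
have -> : a * (e * p') - b * (e * q') = e * (a * p' - b * q') by ring.
rewrite normrM (gtr0_norm e0) -mulrDr ler_pM2l// ler_norml.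
have h1 := sqr_ge0 (a - p'); have h2 := sqr_ge0 (b + q').
have h3 := sqr_ge0 (a + p'); have h4 := sqr_ge0 (b - q').
have h5 := sqr_ge0 a; have h6 := sqr_ge0 b.
have h7 := sqr_ge0 p'; have h8 := sqr_ge0 q'.
by apply/andP; split; lra.
Qed.

(** Choose [e] so small that [e M] is at most [k / 2], and then [n] large. *)
Lemma le0_of_scaled_bounds (k M A : R) : 0 <= M -> 0 <= A ->
  (forall e n, 0 < e -> k <= e * M + A / (e * n.+1%:R)) -> k <= 0.
Proof.
move=> M0 A0 H; rewrite leNgt; apply/negP => k0.
have M1 : 0 < M + 1 by lra.
pose e := k / (2 * (M + 1)).
have e0 : 0 < e by rewrite divr_gt0// mulr_gt0.
have eM : e * M <= k / 2.
  have -> : k / 2 = e * (M + 1) by rewrite /e; field; rewrite gt_eqF.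
  by rewrite ler_pM2l//; lra.
clearbody e; pose n := Num.truncn (2 * A / (e * k)).
have n1 : 2 * A / (e * k) < n.+1%:R by exact: truncnS_gt.
clearbody n; have := H e n e0.
have : A / (e * n.+1%:R) < k / 2.
  have en0 : 0 < e * n.+1%:R by rewrite (mulr_gt0 e0)// ltr0n.
  by move: n1; rewrite (ltr_pdivrMr _ _ (mulr_gt0 e0 k0)) ltr_pdivrMr// => n1; lra.
move: (A / _) => q h1 h2.
have : k < k by rewrite (le_lt_trans h2)//; lra.
by rewrite ltxx.
Qed.

Lemma integral_shell_majorant_fundO N :
  (\int[leb4 R]_(x in fundO beta) (shell_majorant beta N x)%:E <=
   ((N + N).+1%:R * (16 * expR 1 * G ^+ 2))%:E)%E.
Proof.
rewrite -integral_shell_majorant; apply: ge0_subset_integral => //.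
- exact: fundO_measurable.
- by apply/measurable_EFinP; exact: measurable_shell_majorant.
- by move=> x _; rewrite lee_fin shell_majorant_ge0.
Qed.

(** The integrand has a constant sign, and on a fixed box it is bounded away from
0 whatever the scale of the cut-off. *)
Lemma target_pairing_lower_bound : exists2 kappa : R, 0 < kappa &
  forall N, (0 < N)%N ->
  kappa <= `|\int[leb4 R]_(x in fundO beta) complex.Re
              (wedge_form (target_form (R := R)) (cutoff_form N%:R) x [set: 'I_4]%SET)|.
Proof.
have G0 : 0 < G by exact: expR_gt0.
have [E [mE EO Efin E0] Ebox] := bump_box.
have [c c0 cE] := @bump_ge_half R.
(* on the box |z|^2 <= 2, each of the two bumps is at least c, and |w| <= G *)
exists (3 ^- 2 * (c * c) / G ^+ 2 * fine (leb4 R E)).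
  by rewrite !mulr_gt0 ?invr_gt0 ?exprn_gt0.
move=> N N0; have [m top] := wedge_target_form_top (cutoff_form (N%:R : R)).
have NR : (1 : R) <= N%:R by rewrite ler1n.
have NR0 : (0 : R) < N%:R by rewrite ltr0n.
under eq_Rintegral do rewrite top.
have h0 x : fundO beta x ->
    0 <= complex.Re (target_coef x * cutoff_form N%:R x [set iwb]%SET)
      <= shell_majorant beta N x.
  exact: pairing_le_shell_majorant.
rewrite normr_Rintegral_signed; last by move=> x /h0/andP[].
apply: (Rintegral_ge_indic mE EO _ Efin).
- by rewrite !mulr_ge0 ?invr_ge0 ?exprn_ge0 ?(ltW c0) ?(ltW G0).
- by move=> x /h0/andP[].
- move=> x Ex; have [slope [/andP[ln0 ln1] z2]] := Ebox x Ex.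
  have [xO /andP[w1 w2]] := EO _ Ex.
  have [z0 w0] := covO_sqnorm_gt0 xO.
  rewrite (Re_target_coef_cutoff_form _ xO); apply: ler_pM.
  + by rewrite mulr_ge0 ?invr_ge0 ?exprn_ge0// mulr_ge0 ?(ltW c0).
  + by rewrite invr_ge0 exprn_ge0// ltW.
  + apply: ler_pM; rewrite ?invr_ge0 ?exprn_ge0 ?(mulr_ge0 (ltW c0) (ltW c0))//.
      have z1 : 0 < 1 + sqnorm (cplx x.1) by rewrite addr_gt0.
      rewrite lef_pV2 ?posrE ?exprn_gt0//.
      by rewrite ler_pXn2r// ?nnegrE ?(ltW z1)//; lra.
    apply: ler_pM; rewrite ?(ltW c0)//; apply: cE => //.
    rewrite /log_radius normrM (ger0_norm ln0) ger0_norm ?invr_ge0// mulrC.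
    by rewrite ler_pdivrMr//; lra.
  + by rewrite lef_pV2 ?posrE ?exprn_gt0// ltW.
- apply: le_trans (integral_shell_majorant_fundO N).
  apply: ge0_le_integral_nonmeas => x /h0/andP[h1 h2]; first by rewrite lee_fin.
  by rewrite lee_fin.
Qed.

(** The squared norm of [dbar] of the cut-off form is of order [N^-2 |z|^-2] on the
cut-off region, so its integral is of order [1 / N]. The weighted inequality
[Re_mul_le] separates it from the fixed square-integrable form [f]. *)
Lemma dbar_pairing_upper_bound (f : dform R) : L2_form beta 2 0 f ->
  exists M A : R, [/\ 0 <= M, 0 <= A & forall e N, 0 < e -> (0 < N)%N ->
  `|\int[leb4 R]_(x in fundO beta) complex.Re
      (wedge_form f (dbar (cutoff_form N%:R)) x [set: 'I_4]%SET)|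
  <= e * M + A / (e * N%:R)].
Proof.
move=> [_ f20 fmeas fL2].
pose F (x : T4) : R[i] := f x [set iz; iw]%SET.
have sqF0 x : 0 <= sqnorm (F x) by rewrite addr_ge0// sqr_ge0.
have mD := fundO_measurable beta.
have mF : measurable_fun (fundO beta : set T4) (fun x => (sqnorm (F x))%:E : \bar R).
  apply/measurable_EFinP; have [mRe mIm] := fmeas [set iz; iw]%SET.
  apply: (measurable_funS (covO_measurable beta)); first exact: fundO_covO.
  by apply: measurable_funD; apply: measurable_funX.
have [M M0 FM] : exists2 M : R, 0 <= M &
    (\int[leb4 R]_(x in fundO beta) (sqnorm (F x))%:E = M%:E)%E.
  have i0 : (0 <= \int[leb4 R]_(x in fundO beta) (sqnorm (F x))%:E)%E.
    by apply: integral_ge0 => x _; rewrite lee_fin.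
  have : (\int[leb4 R]_(x in fundO beta) (sqnorm (F x))%:E < +oo)%E.
    apply: le_lt_trans fL2; apply: ge0_le_integral_nonmeas => x [xO _].
      by rewrite lee_fin.
    by rewrite lee_fin; exact: sqnorm_le_form.
  move: i0; case: (\int[leb4 R]_(x in _) _)%E => // M M0 _.
  by exists M.
have [C C0 CE] := @dbump_bound R.
pose A : R := 16 * expR 1 * G ^+ 2.
have A0 : 0 <= A by rewrite !mulr_ge0 ?expR_ge0// ltW// expR_gt0.
exists M, (3 * C ^+ 2 * A); split => //; first by rewrite mulr_ge0// mulr_ge0// exprn_ge0// ltW.
move=> e N e0 N0.
have NR : (1 : R) <= N%:R by rewrite ler1n.
have NR0 : (0 : R) < N%:R by rewrite ltr0n.
have [m top] := wedge20_top (dbar (cutoff_form (N%:R : R))) f20.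
pose K := e^-1 * (C ^+ 2 / N%:R ^+ 2).
have K0 : 0 <= K by rewrite mulr_ge0 ?divr_ge0 ?exprn_ge0 ?(ltW C0) ?invr_ge0 ?(ltW e0).
apply: (@Rintegral_norm_le _ _ _ _ _ _ (fun x =>
    e%:E * (sqnorm (F x))%:E + K%:E * (shell_majorant beta N x)%:E)%E).
  move=> x xD; have [xO _] := xD.
  rewrite (top _ xO) normrM normr_sign mul1r.
  rewrite -!EFinM -EFinD lee_fin (le_trans (Re_mul_le _ _ e0))// lerD2l.
  rewrite /K -[leRHS]mulrA ler_pM2l ?invr_gt0//.
  exact: dbar_cutoff_form_bound.
have mW : measurable_fun (fundO beta : set T4) (fun x => (shell_majorant beta N x)%:E : \bar R).
  by apply/measurable_EFinP; exact: measurable_funTS (measurable_shell_majorant _ _).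
have W0 (x : T4) : fundO beta x -> (0 <= (shell_majorant beta N x)%:E :> \bar R)%E.
  by move=> _; rewrite lee_fin shell_majorant_ge0.
have F0 (x : T4) : fundO beta x -> (0 <= (sqnorm (F x))%:E :> \bar R)%E.
  by move=> _; rewrite lee_fin.
have eF0 (x : T4) : fundO beta x -> (0 <= e%:E * (sqnorm (F x))%:E :> \bar R)%E.
  by move=> xD; rewrite mule_ge0 ?F0// lee_fin ltW.
have KW0 (x : T4) : fundO beta x -> (0 <= K%:E * (shell_majorant beta N x)%:E :> \bar R)%E.
  by move=> xD; rewrite mule_ge0 ?W0// lee_fin.
rewrite (ge0_integralD _ mD eF0 (measurable_funeM _ mF) KW0 (measurable_funeM _ mW)).
rewrite (ge0_integralZl_EFin _ mD F0 mF (ltW e0)) (ge0_integralZl_EFin _ mD W0 mW K0).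
rewrite FM (@le_trans _ _ (e%:E * M%:E + K%:E * ((N + N).+1%:R * A)%:E)%E)//.
  rewrite leeD2l// lee_wpmul2l ?lee_fin//.
  exact: integral_shell_majorant_fundO.
rewrite -!EFinM -EFinD lee_fin lerD2l.
have -> : 3 * C ^+ 2 * A / (e * N%:R) = K * ((3 * N%:R) * A).
  by rewrite /K; field; rewrite !gt_eqF.
(* 2 N + 1 <= 3 N *)
rewrite ler_wpM2l// ler_wpM2r// -natr1 natrD; lra.
Qed.

End Pairings.

Theorem proposition5p4 (R : realType) (beta : R) (beta_gt0 : 0 < beta) :
  ~ dbar_range beta 2 0
      (wedge_form (wedge_form (conj_form (phi_form R)) (phi_form R))
                  (psi_form R)).
Proof.
move=> [f [fL2 _ weak]].
have [kappa kappa0 lower] := target_pairing_lower_bound beta_gt0.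
have [M [A [M0 A0 upper]]] := dbar_pairing_upper_bound fL2.
suff : kappa <= 0 by rewrite leNgt kappa0.
apply: (le0_of_scaled_bounds M0 A0) => e n e0.
have N0 : (0 < n.+1)%N by [].
have NR0 : (0 : R) < n.+1%:R by rewrite ltr0n.
apply: le_trans (lower _ N0) _; apply: le_trans _ (upper _ _ e0 N0).
have := weak _ (cutoff_form_test NR0 beta_gt0).
move=> /(congr1 (fun c => `|complex.Re c|)).
rewrite Re_sign !Re_int_domO normrM normrM normr_sign mul1r normrM.
by move=> /mulfI -> //; rewrite normr_eq0 pnatr_eq0.
Qed.
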